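(* Let $X$ be a diffeological space with base point $\ast\in X$. If $X$ is reflexive at $\ast$, then the diffeological loop space $\mathcal{L}(X)$, with the constant loop at $\ast$ as unit $e$, is a smooth h-unital $A_\infty$-space in the category of diffeological spaces; that is, there is a series of smooth maps $M(n): |\mathbb{K}(n)|\times \mathcal{L}(X)^n\to \mathcal{L}(X)$, $n\ge 2$, forming a smooth h-unital $A_\infty$-form on $\mathcal{L}(X)$.
   Context: **Diffeology.** $\mathbb{N}$ is the set of non-negative integers. Diffeological spaces have plots defined on open subsets of Euclidean spaces $\mathbb{R}^m$, $m\in\mathbb{N}$. Subsets carry the subspace diffeology, products the product diffeology, and $C^\infty(A,B)$ the functional diffeology. A subset is $D$-open if its preimage under every plot is open. A subduction is a smooth surjection whose target carries the push-forward diffeology. For smooth maps $f,g:A\to B$, $f\simeq g$ means that they are smoothly homotopic, i.e. there is a smooth map $H:\mathbb{R}\times A\to B$ with $H(0,\cdot)=f$ and $H(1,\cdot)=g$. **Reflexivity.** A diffeological space $Y$ is reflexive if every map $P:U\to Y$ from an open subset $U$ of some $\mathbb{R}^m$, such that $\varphi\circ P$ is smooth for every smooth $\varphi:Y\to\mathbb{R}$, is a plot of $Y$. $X$ is reflexive at $a\in X$ if there is a $D$-open neighbourhood of $a$ in $X$ which is reflexive as a diffeological space. **Paths and loops.** Let $\pi_{set}:\mathbb{R}\to\mathbb{R}$, $\pi_{set}(t)=\max\{0,\min\{1,t\}\}$. $\mathcal{P}(X)=\{u\in C^\infty(\mathbb{R},X)\mid u\circ\pi_{set}=u\}$ and $\mathcal{L}(X)=\{u\in\mathcal{P}(X)\mid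 u(0)=u(1)=\ast\}$, as diffeological subspaces of $C^\infty(\mathbb{R},X)$. **Associahedra as smooth cubic complexes.** For $n\ge2$ let $K_n=\{(t_1,\dots,t_n)\in\mathbb{R}^n\mid t_1=0,\ 0\le t_k\le k-1-\sum_{i=1}^{k-1}t_i\ (1<k<n),\ t_n=n-1-\sum_{i=1}^{n-1}t_i\}$, and let $\mathbb{b}_n=(0,\tfrac12,\dots,\tfrac12,\tfrac n2)\in K_n$ (so $\mathbb b_2=(0,1)$ and $K_2=\{\mathbb b_2\}$). For $r,s\ge2$, $r+s=n+1$, $1\le k\le r$, the face operator $\partial_k:\mathbb{R}^r\times\mathbb{R}^s\to\mathbb{R}^n$ is the linear map $\partial_k((t_1,\dots,t_r),(u_1,\dots,u_s))=(t_1,\dots,t_{k-1},u_1,\dots,u_{s-1},u_s+t_k,t_{k+1},\dots,t_r)$ (for $k=1$ this reads $(u_1,\dots,u_{s-1},u_s+t_1,t_2,\dots,t_r)$); it maps $K_r\times K_s$ bijectively onto a face $L_k(r,s)$ of $K_n$. The boundary of $K_n$ is the union of these faces, and $K_n$ is the union of the cones $L_k(r,s)\ast\mathbb b_n$ (for $n\ge3$). The cubic complex $\mathbb{K}(n)$ is a finite set of cells $\sigma\subset K_n$, each nonempty cell equipped with a surjection $\pi_\sigma:\mathbb{R}^q\to\sigma$, $q=\dim\sigma$, defined inductively: - $\mathbb{K}(2)=\{\emptyset,\{\mathbb b_2\}\}$. - For $n\ge3$, $\mathbb{K}(n)$ consists of $\emptyset$, $\{\mathbb b_n\}$, all cells $\sigma=\partial_k(\rho\times\kappa)$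 with $r+s=n+1$, $r,s\ge 2$, $1\le k\le r$ and nonempty $\rho\in\mathbb{K}(r)$, $\kappa\in\mathbb{K}(s)$, where $\pi_\sigma=\partial_k\circ(\pi_\rho\times\pi_\kappa)$, and all joins $\sigma\ast\mathbb b_n=\{(1-t)x+t\,\mathbb b_n\mid x\in\sigma,\ t\in[0,1]\}$ of such $\sigma$, where $\pi_{\sigma\ast\mathbb b_n}(x,t)=(1-\pi_{set}(t))\pi_\sigma(x)+\pi_{set}(t)\,\mathbb b_n$ for $(x,t)\in\mathbb{R}^{\dim\sigma}\times\mathbb{R}$. Each cell $\sigma$ carries the diffeology for which $\pi_\sigma$ is a subduction (one-point cells are trivial). $|\mathbb{K}(n)|$ is $K_n$ as a set, with the diffeology of the colimit of the cells (the finest diffeology for which all inclusions of cells are smooth). **h-unital $A_\infty$-space.** A diffeological space $G$ with base point $e$ (the unit) is a smooth h-unital $A_\infty$-space if there is a series of smooth maps $\{M(n):|\mathbb{K}(n)|\times G^n\to G\}_{n\ge2}$ (an $A_\infty$-form) such that: (1) $M(n)(\partial_k(\rho,\kappa);g_1,\dots,g_n)=M(r)(\rho;g_1,\dots,g_{k-1},M(s)(\kappa;g_k,\dots,g_{k+s-1}),g_{k+s},\dots,g_n)$ for all $r,s\ge2$, $r+s=n+1$, $1\le k\le r$, $\rho\in|\mathbb{K}(r)|$, $\kappa\in|\mathbb{K}(s)|$, $g_i\in G$; (2') the maps $g\mapsto M(2)(\mathbb b_2;e,g)$ and $g\mapsto M(2)(\mathbb b_2;g,e)$ are each smoothly homotopic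 to the identity of $G$. *)

(* Defs.v *)
From HB Require Import structures.
From mathcomp Require Import all_boot all_order all_algebra.
From mathcomp Require Import boolp classical_sets functions reals.
From mathcomp Require Import topology normedtype landau derive.
From mathcomp Require Import lra zify.

Set Implicit Arguments.
Unset Strict Implicit.
Unset Printing Implicit Defensive.

Import Order.TTheory GRing.Theory Num.Theory numFieldNormedType.Exports.

Local Open Scope classical_set_scope.
Local Open Scope ring_scope.

Section Smooth.
Variable R : realType.

Definition partials m (s : seq 'I_m) (f : 'rV[R]_m -> R) : 'rV[R]_m -> R :=
  foldl (fun g i => 'D_(delta_mx 0 i) g) f s.

(* Infinitely differentiable at every point of [U] (meaningful for open [U]):
   all iterated partial derivatives exist and are differentiable there. *)
Definition smooth_fun m (U : set 'rV[R]_m) (f : 'rV[R]_m -> R) :=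
  forall (s : seq 'I_m) x, U x -> differentiable (partials s f) x.

Definition smooth_map m n (U : set 'rV[R]_m) (f : 'rV[R]_m -> 'rV[R]_n) :=
  forall j, smooth_fun U (fun x => f x 0 j).

Definition smooth_upto k m (U : set 'rV[R]_m) (f : 'rV[R]_m -> R) :=
  forall s : seq 'I_m, (size s <= k)%N ->
  forall x, U x -> differentiable (partials s f) x.

Lemma smooth_funP m (U : set 'rV[R]_m) f : smooth_fun U f <-> forall k, smooth_upto k U f.
Proof.
split=> [sf k s _|sf s]; first exact: sf.
exact: (sf (size s)).
Qed.

Lemma smooth_uptoS k m (U : set 'rV[R]_m) f : smooth_upto k.+1 U f <->
  (forall x, U x -> differentiable f x) /\
  (forall i, smooth_upto k U ('D_(delta_mx 0 i) f)).
Proof.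
split=> [sf|[df sf] [|i s] /=].
- split=> [x Ux|i s ss x Ux]; first exact: (sf [::]).
  exact: (sf (i :: s)).
- by move=> _ x Ux; exact: df.
- exact: sf.
Qed.

Lemma smooth_upto_diff k m (U : set 'rV[R]_m) f :
  smooth_upto k U f -> forall x, U x -> differentiable f x.
Proof. by move=> sf; exact: (sf [::]). Qed.

Lemma smooth_upto_le k m (U : set 'rV[R]_m) f : smooth_upto k.+1 U f -> smooth_upto k U f.
Proof. by move=> sf s ss; apply: sf; apply: leq_trans ss _. Qed.

Lemma near_eq_differentiable m (f g : 'rV[R]_m -> R) x :
  {near x, f =1 g} -> differentiable f x -> differentiable g x.
Proof.
move=> fg df; have fgx := nbhs_singleton fg.
have [dfc fE] := proj1 (diff_locallyP x f) df.
have gE : g \o shift x = cst (g x) + 'd f x +o_ 0 id.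
  apply/eqaddoP => e e0; move: fE => /eqaddoP /(_ e e0) fE.
  have fg0 : \forall y \near (0 : 'rV[R]_m), f (y + x) = g (y + x).
    by move: fg; rewrite (near_shift 0)/=; apply: filterS => y; rewrite /= subr0.
  apply: filterS2 fE fg0 => y fEy fgy; rewrite -fgx.
  suff -> : (g \o shift x - (cst (f x) + 'd f x)) y =
            (f \o shift x - (cst (f x) + 'd f x)) y by [].
  by rewrite !fctE/= -fgy.
by apply/diff_locallyP; rewrite (diff_unique dfc gE).
Qed.

Lemma near_open m (U : set 'rV[R]_m) (f g : 'rV[R]_m -> R) x :
  open U -> {in U, f =1 g} -> U x -> {near x, f =1 g}.
Proof.
move=> oU fg Ux; have /open_nbhs_nbhs := conj oU Ux.
by apply: filterS => y Uy; apply: fg; rewrite inE.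
Qed.

Lemma smooth_upto_ext k m (U : set 'rV[R]_m) (f g : 'rV[R]_m -> R) :
  open U -> {in U, f =1 g} -> smooth_upto k U f -> smooth_upto k U g.
Proof.
move=> oU; elim: k f g => [|k IH] f g fg sf.
  case=> // _ x Ux /=; apply: (near_eq_differentiable (near_open oU fg Ux)).
  exact: (sf [::]).
move: sf => /smooth_uptoS[df sf]; apply/smooth_uptoS; split=> [x Ux|i].
  exact: (near_eq_differentiable (near_open oU fg Ux) (df _ Ux)).
apply: IH (sf i) => x; rewrite inE => Ux.
exact/near_eq_derive/(near_open oU fg Ux).
Qed.

Lemma smooth_upto_cst k m (U : set 'rV[R]_m) (c : R) : smooth_upto k U (cst c).
Proof.
elim: k c => [|k IH] c; first by case=> // _ x _ /=; exact: differentiable_cst.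
apply/smooth_uptoS; split=> [x _|i]; first exact: differentiable_cst.
suff -> : 'D_(delta_mx 0 i) (cst c) = cst 0 :> ('rV[R]_m -> R) by [].
by apply/funext => x; rewrite derive_cst.
Qed.

Lemma smooth_upto_add k m (U : set 'rV[R]_m) (f g : 'rV[R]_m -> R) :
  open U -> smooth_upto k U f -> smooth_upto k U g -> smooth_upto k U (f + g).
Proof.
move=> oU; elim: k f g => [|k IH] f g sf sg.
  by case=> // _ x Ux /=; apply: differentiableD; apply: smooth_upto_diff Ux; eassumption.
move: sf sg => /smooth_uptoS[df sf] /smooth_uptoS[dg sg]; apply/smooth_uptoS; split=> [x Ux|i].
  by apply: differentiableD; [exact: df|exact: dg].
apply: smooth_upto_ext (IH _ _ (sf i) (sg i)) => // x; rewrite inE => Ux.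
by rewrite deriveD//; apply: diff_derivable; [exact: df|exact: dg].
Qed.

Lemma smooth_upto_mul k m (U : set 'rV[R]_m) (f g : 'rV[R]_m -> R) :
  open U -> smooth_upto k U f -> smooth_upto k U g -> smooth_upto k U (f * g).
Proof.
move=> oU; elim: k f g => [|k IH] f g sf sg.
  by case=> // _ x Ux /=; apply: differentiableM; apply: smooth_upto_diff Ux; eassumption.
have sf' := smooth_upto_le sf; have sg' := smooth_upto_le sg.
move: sf sg => /smooth_uptoS[df sf] /smooth_uptoS[dg sg]; apply/smooth_uptoS; split=> [x Ux|i].
  by apply: differentiableM; [exact: df|exact: dg].
apply: smooth_upto_ext (smooth_upto_add oU (IH _ _ sf' (sg i)) (IH _ _ sg' (sf i))) => //.
move=> x; rewrite inE => Ux.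
by rewrite deriveM//; apply: diff_derivable; [exact: df|exact: dg].
Qed.

Lemma smooth_upto_sum k m n (U : set 'rV[R]_m) (F : 'I_n -> 'rV[R]_m -> R) :
  open U -> (forall j, smooth_upto k U (F j)) -> smooth_upto k U (\sum_j F j).
Proof.
move=> oU sF; elim/big_ind: _ => [|f g sf sg|j _].
- exact: smooth_upto_cst.
- exact: smooth_upto_add.
- exact: sF.
Qed.

Lemma differentiable_row m n (h : 'rV[R]_m -> 'rV[R]_n) x :
  (forall j, differentiable (fun y => h y 0 j) x) -> differentiable h x.
Proof.
move=> dh; rewrite (_ : h = \sum_j (fun y => h y 0 j *: delta_mx 0 j)).
  by apply: differentiable_sum => j; exact: differentiableZl.
by apply/funext => y; rewrite fct_sumE [LHS]row_sum_delta.
Qed.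

Lemma derive_coord m n (h : 'rV[R]_m -> 'rV[R]_n) x v j :
  differentiable h x -> 'D_v (fun y => h y 0 j) x = ('D_v h x) 0 j.
Proof.
move=> dh; rewrite !deriveE//; last first.
  exact: (differentiable_comp dh (differentiable_coord _ _ _)).
rewrite (_ : (fun y => h y 0 j) = (fun M : 'rV[R]_n => M 0 j : R) \o h)//.
rewrite diff_comp//; last exact: differentiable_coord.
have @f : {linear 'rV[R]_n -> R}.
  by exists (fun N : 'rV[R]_n => N 0 j); do 2![eexists]; do ?[constructor];
     rewrite ?mxE// => ? *; rewrite ?mxE//; move=> ?; rewrite !mxE.
rewrite /= (_ : (fun M : 'rV[R]_n => M 0 j : R) = f)// diff_lin//.
exact: coord_continuous.
Qed.

Lemma derive_comp m n (h : 'rV[R]_m -> 'rV[R]_n) (f : 'rV[R]_n -> R) x v :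
  differentiable h x -> differentiable f (h x) ->
  'D_v (f \o h) x =
  \sum_j 'D_v (fun y => h y 0 j) x * 'D_(delta_mx 0 j) f (h x).
Proof.
move=> dh df; rewrite deriveE; last exact: differentiable_comp.
rewrite diff_comp//= -(deriveE _ dh) [X in 'd f _ X]row_sum_delta linear_sum.
apply: eq_bigr => j _; rewrite linearZ/= derive_coord//.
by rewrite (deriveE _ df).
Qed.

Lemma smooth_upto_comp k m n (U : set 'rV[R]_m) (V : set 'rV[R]_n)
    (h : 'rV[R]_m -> 'rV[R]_n) (f : 'rV[R]_n -> R) :
  open U -> h @` U `<=` V -> (forall j, smooth_upto k U (fun x => h x 0 j)) ->
  smooth_upto k V f -> smooth_upto k U (f \o h).
Proof.
move=> oU hUV.
have dh l : (forall j, smooth_upto l U (fun x => h x 0 j)) ->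
    forall x, U x -> differentiable h x.
  by move=> sh x Ux; apply: differentiable_row => j; exact: smooth_upto_diff Ux.
have Vh x : U x -> V (h x) by move=> Ux; apply: hUV; exists x.
elim: k f => [|k IH] f sh sf.
  case=> // _ x Ux /=; apply: differentiable_comp; first exact: dh Ux.
  exact: smooth_upto_diff sf _ (Vh _ Ux).
have sh' j := smooth_upto_le (sh j).
move: sf => /smooth_uptoS[df sf]; apply/smooth_uptoS; split=> [x Ux|i].
  by apply: differentiable_comp; [exact: dh Ux|exact/df/Vh].
apply: (@smooth_upto_ext _ _ _ (\sum_j ('D_(delta_mx 0 i) (fun y => h y 0 j)) *
    ('D_(delta_mx 0 j) f \o h)%R)) => //.
  move=> x; rewrite inE => Ux.
  rewrite derive_comp//; [|exact: dh Ux|exact/df/Vh].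
  by rewrite fct_sumE.
apply: smooth_upto_sum => // j; apply: smooth_upto_mul => //; last exact: IH.
by move: (sh j) => /smooth_uptoS[].
Qed.

Lemma smooth_fun_ext m (U : set 'rV[R]_m) f g :
  open U -> {in U, f =1 g} -> smooth_fun U f -> smooth_fun U g.
Proof. by move=> oU fg /smooth_funP sf; apply/smooth_funP => k; exact: smooth_upto_ext (sf k). Qed.

Lemma smooth_fun_cst m (U : set 'rV[R]_m) c : smooth_fun U (cst c).
Proof. by apply/smooth_funP => k; exact: smooth_upto_cst. Qed.

Lemma smooth_fun_comp m n (U : set 'rV[R]_m) (V : set 'rV[R]_n) h f :
  open U -> h @` U `<=` V -> smooth_map U h -> smooth_fun V f ->
  smooth_fun U (f \o h).
Proof.
move=> oU hUV sh /smooth_funP sf; apply/smooth_funP => k; apply: smooth_upto_comp (sf k) => // j.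
by have /smooth_funP := sh j.
Qed.

Lemma smooth_map_id m (U : set 'rV[R]_m) : smooth_map U id.
Proof.
move=> j; apply/smooth_funP => -[|k].
  by case=> // _ x _ /=; exact: differentiable_coord.
apply/smooth_uptoS; split=> [x _|i]; first exact: differentiable_coord.
have -> : 'D_(delta_mx 0 i) (fun y : 'rV[R]_m => y 0 j) =
    cst ((delta_mx 0 i : 'rV[R]_m) 0 j).
  by apply/funext => x; rewrite (@derive_coord m m id) ?derive_id.
exact: smooth_upto_cst.
Qed.

Lemma smooth_map_differentiable m n (U : set 'rV[R]_m) (h : _ -> 'rV[R]_n) x :
  smooth_map U h -> U x -> differentiable h x.
Proof. by move=> sh Ux; apply: differentiable_row => j; exact: (sh j [::]). Qed.

End Smooth.

(* A parametrization [P : U -> T] of an open subset [U] of R^m is a total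
   function on R^m of which only the values on [U] matter ([plot_ext]). *)
Record diffeology (R : realType) (T : Type) := Diffeology {
  is_plot : forall m, set 'rV[R]_m -> ('rV[R]_m -> T) -> Prop;
  plot_open : forall m (U : set 'rV[R]_m) P, is_plot U P -> open U;
  plot_ext : forall m (U : set 'rV[R]_m) P Q,
    {in U, P =1 Q} -> is_plot U P -> is_plot U Q;
  plot_cst : forall m (U : set 'rV[R]_m) t, open U -> is_plot U (cst t);
  plot_local : forall m (U : set 'rV[R]_m) P,
    (forall x, U x -> exists V, [/\ V x, V `<=` U & is_plot V P]) ->
    is_plot U P;
  plot_comp : forall m n (U : set 'rV[R]_m) (V : set 'rV[R]_n) P h,
    is_plot U P -> open V -> smooth_map V h -> h @` V `<=` U ->
    is_plot V (P \o h) }.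

Record diffSpace (R : realType) := DiffSpace {
  dcarrier :> Type;
  dstruct : diffeology R dcarrier }.

Definition plot (R : realType) (X : diffSpace R) m (U : set 'rV[R]_m)
  (P : 'rV[R]_m -> X) := is_plot (dstruct X) U P.

Definition smooth (R : realType) (X Y : diffSpace R) (f : X -> Y) :=
  forall m (U : set 'rV[R]_m) (P : 'rV[R]_m -> X), plot U P -> plot U (f \o P).

Lemma open_local (T : topologicalType) (U : set T) :
  (forall x, U x -> exists V, [/\ V x, V `<=` U & open V]) -> open U.
Proof.
move=> H; rewrite openE => x /H[V [Vx VU oV]].
by apply: (filterS VU); apply: open_nbhs_nbhs.
Qed.

Lemma plot_restrict (R : realType) T (D : diffeology R T) m
    (U V : set 'rV[R]_m) P :
  open V -> V `<=` U -> is_plot D U P -> is_plot D V P.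
Proof.
move=> oV VU pP; apply: (plot_comp (h := id) pP oV) => [|_ [x Vx <-]].
  exact: smooth_map_id.
exact: VU.
Qed.

Section Real.
Variable R : realType.

Definition real_plot m (U : set 'rV[R]_m) (f : 'rV[R]_m -> R) :=
  open U /\ smooth_fun U f.

Definition real_diffeology : diffeology R R.
Proof.
exists real_plot.
- by move=> m U P [].
- by move=> m U P Q PQ [oU sP]; split=> //; exact: smooth_fun_ext sP.
- by move=> m U t oU; split=> //; exact: smooth_fun_cst.
- move=> m U P H; split.
    by apply: open_local => x /H[V [Vx VU [oV _]]]; exists V.
  by move=> s x /H[V [Vx VU [_ sP]]]; exact: sP.
- by move=> m n U V P h [oU sP] oV sh hVU; split=> //; exact: smooth_fun_comp sP.
Defined.

Definition real_space : diffSpace R := DiffSpace real_diffeology.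

Definition eucl_plot q m (U : set 'rV[R]_m) (f : 'rV[R]_m -> 'rV[R]_q) :=
  open U /\ smooth_map U f.

Definition eucl_diffeology q : diffeology R 'rV[R]_q.
Proof.
exists (@eucl_plot q).
- by move=> m U P [].
- move=> m U P Q PQ [oU sP]; split=> // j.
  by apply: smooth_fun_ext (sP j) => // x xU; rewrite PQ.
- by move=> m U t oU; split=> // j; exact: smooth_fun_cst.
- move=> m U P H; split.
    by apply: open_local => x /H[V [Vx VU [oV _]]]; exists V.
  by move=> j s x /H[V [Vx VU [_ sP]]]; exact: (sP j).
- move=> m n U V P h [oU sP] oV sh hVU; split=> // j.
  exact: (smooth_fun_comp oV hVU sh (sP j)).
Defined.

Definition eucl_space q : diffSpace R := DiffSpace (eucl_diffeology q).

End Real.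

Section Constructions.
Variable R : realType.
Implicit Types X Y A B : diffSpace R.

Definition sub_diffeology X (S : set X) : diffeology R S.
Proof.
exists (fun m U P => plot U (fun x => \val (P x) : X)).
- by move=> m U P; exact: plot_open.
- by move=> m U P Q PQ; apply: plot_ext => x xU; rewrite PQ.
- by move=> m U t oU; exact: (plot_cst (dstruct X) (\val t) oU).
- by move=> m U P; exact: plot_local.
- by move=> m n U V P h; exact: plot_comp.
Defined.

Definition sub_space X (S : set X) : diffSpace R :=
  DiffSpace (sub_diffeology S).

Definition prod_diffeology X Y : diffeology R (X * Y)%type.
Proof.
exists (fun m U P => plot U (fun x => (P x).1) /\ plot U (fun x => (P x).2)).
- by move=> m U P [/plot_open].
- by move=> m U P Q PQ [P1 P2]; split; [apply: plot_ext P1|apply: plot_ext P2];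
    move=> x xU; rewrite PQ.
- by move=> m U t oU; split;
    [exact: (plot_cst _ t.1 oU)|exact: (plot_cst _ t.2 oU)].
- by move=> m U P H; split; apply: plot_local => x /H[V [Vx VU [P1 P2]]];
    exists V.
- move=> m n U V P h [P1 P2] oV sh hVU.
  by split; [exact: (plot_comp P1)|exact: (plot_comp P2)].
Defined.

Definition prod_space X Y : diffSpace R := DiffSpace (prod_diffeology X Y).

Definition pow_diffeology X n : diffeology R (n.-tuple X).
Proof.
exists (fun m U P => open U /\ forall i, plot U (fun x => tnth (P x) i)).
- by move=> m U P [].
- move=> m U P Q PQ [oU H]; split=> // i; apply: plot_ext (H i) => x xU.
  by rewrite PQ.
- by move=> m U t oU; split=> // i; exact: (plot_cst _ (tnth t i) oU).
- move=> m U P H; split=> [|i].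
    by apply: open_local => x /H[V [Vx VU [oV _]]]; exists V.
  apply: plot_local => x /H[V [Vx VU [_ sP]]]; exists V; split=> //.
  exact: sP.
- by move=> m k U V P h [oU H] oV sh hVU; split=> // i; exact: (plot_comp (H i)).
Defined.

Definition pow_space X n : diffSpace R := DiffSpace (pow_diffeology X n).

(* Functional diffeology: [P] is a plot when [(u, a) |-> P u a] is smooth on
   [U * A], i.e. sends each plot [(h, Q) : V -> U * A] to a plot of [B]. *)
Definition fun_plot A B m (U : set 'rV[R]_m)
    (P : 'rV[R]_m -> [set f : A -> B | smooth f]) :=
  open U /\
  forall n (V : set 'rV[R]_n) (h : 'rV[R]_n -> 'rV[R]_m) (Q : 'rV[R]_n -> A),
    smooth_map V h -> h @` V `<=` U -> plot V Q ->
    plot V (fun v => \val (P (h v)) (Q v)).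

Definition fun_diffeology A B : diffeology R [set f : A -> B | smooth f].
Proof.
exists (@fun_plot A B).
- by move=> m U P [].
- move=> m U P Q PQ [oU H]; split=> // n V h S sh hVU pS.
  apply: plot_ext (H _ _ _ _ sh hVU pS) => x; rewrite inE => Vx.
  by rewrite PQ// inE; apply: hVU; exists x.
- by move=> m U t oU; split=> // n V h S _ _; exact: (set_valP t).
- move=> m U P H; split.
    by apply: open_local => x /H[V [Vx VU [oV _]]]; exists V.
  move=> n W h S sh hWU pS; have oW := plot_open pS.
  apply: plot_local => w Ww; have /hWU /H[V [Vhw VU [oV HV]]] : (h @` W) (h w).
    by exists w.
  have oWV : open (W `&` h @^-1` V).
    apply: open_local => x [Wx Vhx].
    have /differentiable_continuous ch := smooth_map_differentiable sh Wx.
    have hV : nbhs x (h @^-1` V) := ch V (open_nbhs_nbhs (conj oV Vhx)).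
    have : nbhs x (W `&` h @^-1` V).
      by apply: filterI (open_nbhs_nbhs (conj oW Wx)) hV.
    by rewrite nbhsE; case=> O [oO Ox] OWV; exists O; split.
  exists (W `&` h @^-1` V); split=> //.
  apply: HV; last 1 first.
  - by apply: plot_restrict pS => // x [].
  - by move=> j s x [Wx _]; exact: sh.
  - by move=> _ [x [_ Vhx] <-].
- move=> m n U V P h [oU H] oV sh hVU; split=> // k W g Q sg gWV pQ.
  apply: (H _ _ (h \o g)) => //; last first.
    by move=> _ [x Wx <-]; apply: hVU; exists (g x) => //; apply: gWV; exists x.
  by move=> j; apply: smooth_fun_comp gWV sg (sh j); exact: plot_open pQ.
Defined.

End Constructions.

Section Finest.
Variables (R : realType) (T : Type).

(* The finest diffeology on [T] satisfying [C]: the intersection of all the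
   diffeologies satisfying [C]. *)
Definition finest_diffeology (C : diffeology R T -> Prop) : diffeology R T.
Proof.
exists (fun m U P => open U /\ forall D, C D -> is_plot D U P).
- by move=> m U P [].
- move=> m U P Q PQ [oU H]; split=> // D CD.
  by apply: plot_ext PQ _; exact: H.
- by move=> m U t oU; split=> // D _; exact: plot_cst.
- move=> m U P H; split=> [|D CD].
    by apply: open_local => x /H[V [Vx VU [oV _]]]; exists V.
  apply: plot_local => x /H[V [Vx VU [_ HV]]]; exists V; split=> //.
  exact: HV.
- move=> m k U V P h [oU H] oV sh hVU; split=> // D CD.
  exact: plot_comp (H _ CD) oV sh hVU.
Defined.

End Finest.

Section Notions.
Variable R : realType.
Implicit Types X Y A B : diffSpace R.

Definition pushforward X T (f : X -> T) : diffeology R T :=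
  finest_diffeology (fun D => @smooth R X (DiffSpace D) f).

Definition D_open X (S : set X) :=
  forall m (U : set 'rV[R]_m) (P : 'rV[R]_m -> X),
    plot U P -> open (U `&` P @^-1` S).

Definition reflexive Y :=
  forall m (U : set 'rV[R]_m) (P : 'rV[R]_m -> Y), open U ->
    (forall phi : Y -> real_space R, smooth phi -> plot U (phi \o P)) ->
    plot U P.

Definition reflexive_at X (a : X) :=
  exists S : set X, [/\ D_open S, S a & reflexive (sub_space S)].

Definition homotopic A B (f g : A -> B) :=
  exists H : prod_space (real_space R) A -> B,
    [/\ smooth H, forall a, H (0, a) = f a & forall a, H (1, a) = g a].

Definition fun_space A B : diffSpace R := DiffSpace (fun_diffeology A B).

Definition pi_set (t : R) : R := Num.max 0 (Num.min 1 t).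

Definition paths X : set (fun_space (real_space R) X) :=
  [set u | \val u \o pi_set = \val u].

Definition loops X (a : X) : set (fun_space (real_space R) X) :=
  [set u | [/\ paths u, \val u 0 = a & \val u 1 = a]].

Definition loop_space X (a : X) : diffSpace R := sub_space (loops a).

Lemma smooth_const A B (b : B) : smooth (fun _ : A => b).
Proof. by move=> m U P /plot_open oU; exact: (plot_cst (dstruct B) b oU). Qed.

Definition const_path X (a : X) : fun_space (real_space R) X :=
  SigSub (mem_set (@smooth_const (real_space R) X a : [set f | smooth f] _)).

Lemma const_path_loop X (a : X) : loops a (const_path a).
Proof. by []. Qed.

Definition const_loop X (a : X) : loop_space a :=
  SigSub (mem_set (const_path_loop a)).

End Notions.

Section Associahedra.
Variable R : realType.

(* 0-based coordinates: [coord t i] is $t_{i+1}$, and is 0 out of range. *)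
Definition coord n (t : 'rV[R]_n) (i : nat) : R := oapp (t 0) 0 (insub i).

Definition assoc n : set 'rV[R]_n :=
  [set t | [/\ coord t 0 = 0,
    forall i, (0 < i < n.-1)%N ->
      0 <= coord t i <= i%:R - \sum_(j < i) coord t j &
    coord t n.-1 = n.-1%:R - \sum_(j < n.-1) coord t j]].

Definition bary n : 'rV[R]_n :=
  \row_i (if i == 0%N :> nat then 0
          else if i == n.-1 :> nat then n%:R / 2 else 1 / 2).

(* For [k : 'I_r] (0-based) this is $\partial_{k+1}$. *)
Definition face r s (k : 'I_r) (t : 'rV[R]_r) (u : 'rV[R]_s) :
    'rV[R]_((r + s).-1) :=
  \row_i (if (i < k)%N then coord t i
          else if (i < k + s.-1)%N then coord u (i - k)
          else if i == (k + s.-1)%N :> nat then coord u s.-1 + coord t k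
          else coord t (i - s.-1)).

Lemma coordE n (t : 'rV[R]_n) (i : 'I_n) : coord t i = t 0 i.
Proof. by rewrite /coord valK. Qed.

Lemma coord_bary n i : coord (bary n) i =
  if (i < n)%N then (if i == 0%N then 0
          else if i == n.-1 then n%:R / 2 else 1 / 2) else 0.
Proof.
by rewrite /coord; case: insubP => [j -> <-|/negbTE->] //=; rewrite mxE.
Qed.

Lemma coord_face r s (k : 'I_r) (t : 'rV[R]_r) (u : 'rV[R]_s) i :
  (1 < s)%N -> coord (face k t u) i =
  if (i < k)%N then coord t i
  else if (i < k + s.-1)%N then coord u (i - k)
  else if i == (k + s.-1)%N :> nat then coord u s.-1 + coord t k
  else coord t (i - s.-1).
Proof.
move=> s1; rewrite {1}/coord; case: insubP => [j _ <-|]/=; first by rewrite mxE.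
rewrite -leqNgt => ir; have kr := ltn_ord k.
rewrite !ifF; [|lia..].
by rewrite /coord insubF//; lia.
Qed.

Definition psum n (t : 'rV[R]_n) i := \sum_(j < i) coord t j.

Lemma psumS n (t : 'rV[R]_n) i : psum t i.+1 = psum t i + coord t i.
Proof. by rewrite /psum big_ord_recr. Qed.

Lemma psum_face r s (k : 'I_r) (t : 'rV[R]_r) (u : 'rV[R]_s) : (1 < s)%N ->
  [/\ forall i, (i <= k)%N -> psum (face k t u) i = psum t i,
      forall i, (i <= s.-1)%N ->
        psum (face k t u) (k + i) = psum t k + psum u i &
      forall i, psum (face k t u) (k + s + i) = psum t (k.+1 + i) + psum u s].
Proof.
move=> s1.
have H1 i : (i <= k)%N -> psum (face k t u) i = psum t i.
  move=> ik; apply: eq_bigr => j _; rewrite coord_face// ifT//.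
  by have := ltn_ord j; lia.
have H2 i : (i <= s.-1)%N -> psum (face k t u) (k + i) = psum t k + psum u i.
  elim: i => [|i IH] le_i; first by rewrite addn0 H1// /psum big_ord0 addr0.
  rewrite addnS !psumS IH; last by lia.
  rewrite coord_face// ifF ?ifT; [|lia..].
  by rewrite addKn addrA.
split=> //; elim=> [|i IH].
  rewrite !addn0 (_ : k + s = (k + s.-1).+1)%N; last by lia.
  rewrite psumS H2// coord_face// ifF; last by lia.
  rewrite ifF ?eqxx; last by lia.
  have -> : psum u s = psum u s.-1 + coord u s.-1 by rewrite -psumS prednK// ltnW.
  by rewrite psumS; lra.
rewrite addnS psumS IH coord_face// !ifF; [|lia..].
rewrite addnS psumS (_ : k + s + i - s.-1 = k.+1 + i)%N; last by lia.
by lra.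
Qed.

Lemma assoc_psum n (t : 'rV[R]_n) i : assoc t -> (i < n.-1)%N ->
  0 <= coord t i /\ psum t i.+1 <= i%:R.
Proof.
move=> [t0 H _] i_n; rewrite psumS; case: i => [|i] in i_n *.
  by rewrite t0 /psum big_ord0 addr0 lexx.
by have /andP[? ?] := H i.+1 i_n; split=> //; rewrite /psum; lra.
Qed.

Lemma assoc_face r s (k : 'I_r) (t : 'rV[R]_r) (u : 'rV[R]_s) :
  (1 < r)%N -> (1 < s)%N -> assoc t -> assoc u -> assoc (face k t u).
Proof.
move=> r1 s1 At Au; have [F1 F2 F3] := psum_face k t u s1.
have kr := ltn_ord k.
have [t0 tE tr] := At; have [u0 uE us] := Au.
have psum0 m (v : 'rV[R]_m) : psum v 0 = 0 by rewrite /psum big_ord0.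
have ptk : psum t k <= k%:R.
  case Ek : (val k) => [|q]; first by rewrite psum0.
  have [|_ h] := assoc_psum (i := q) At; first by move: kr; rewrite Ek; lia.
  by rewrite (le_trans h)// ler_nat.
have pus : psum u s.-1 <= s.-1%:R.
  case Es : s.-1 => [|q]; first by rewrite psum0.
  have [|_ h] := assoc_psum (i := q) Au; first by lia.
  by rewrite (le_trans h)// ler_nat.
have tk' : coord t k <= k%:R - psum t k /\ ((k < r.-1)%N -> 0 <= coord t k) /\
    (k = r.-1 :> nat -> coord t k = k%:R - psum t k).
  have [kl|kl] := ltnP k r.-1.
    split; last by split=> [_|]; [have [] := assoc_psum At kl|lia].
    have [k0|k0] := posnP k; first by rewrite k0 t0 psum0 subr0.
    by have /andP[] := tE _ (introT andP (conj k0 kl)).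
  have Ek : k = r.-1 :> nat by lia.
  by split; [rewrite Ek tr|split=> // _; rewrite Ek tr].
have psur : psum u s = s.-1%:R.
  by rewrite -{2}[s](prednK (ltnW s1)) psumS us -/(psum _ _); lra.
split.
- rewrite coord_face//; have [k0|k0] := posnP k; last by rewrite t0.
  by rewrite /= sub0n u0 ifT//; lia.
- move=> i /andP[i0 il]; rewrite -/(psum _ _) coord_face//.
  have [ik|ki] := ltnP i k.
    by rewrite F1 ?(ltnW ik)//; apply: tE; rewrite i0; lia.
  have [j Ej] : {j | i = (k + j)%N} by exists (i - k)%N; rewrite subnKC.
  subst i; have [js|sj] := ltnP (k + j) (k + s.-1).
    rewrite addKn F2; last by lia.
    have [j0|j0] := posnP j.
      by rewrite j0 u0 psum0 addn0; lra.
    have /andP[? ?] : 0 <= coord u j <= j%:R - psum u j by apply: uE; lia.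
    by rewrite natrD; apply/andP; split=> //; lra.
  case: eqP => [jE|jE].
    have {}jE : j = s.-1 by lia.
    subst j; rewrite F2// us -/(psum _ _) natrD; have [? [h _]] := tk'.
    have ? := h ltac:(lia).
    by apply/andP; split; lra.
  have [l El] : {l | j = (s + l)%N} by exists (j - s)%N; lia.
  subst j; rewrite addnA F3 psur.
  rewrite (_ : k + s + l - s.-1 = k.+1 + l)%N; last by lia.
  have /andP[? ?] : 0 <= coord t (k.+1 + l) <= (k.+1 + l)%:R - psum t (k.+1 + l).
    by apply: tE; lia.
  apply/andP; split=> //.
  rewrite (_ : (k + s + l)%:R = (k.+1 + l)%:R + s.-1%:R :> R); last first.
    by rewrite -natrD; congr (_%:R); lia.
  by lra.
- rewrite -/(psum _ _) coord_face// ifF; last by lia.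
  rewrite ifF; last by lia.
  have [kl|kl] := ltnP k r.-1.
    rewrite ifF; last by lia.
    rewrite (_ : (r + s).-1.-1 - s.-1 = r.-1)%N; last by lia.
    have [l El] : {l | r.-1 = (k.+1 + l)%N} by exists (r.-1 - k.+1)%N; lia.
    rewrite (_ : (r + s).-1.-1 = k + s + l)%N; last by lia.
    rewrite F3 psur -El tr -/(psum _ _).
    rewrite (_ : k + s + l = r.-1 + s.-1)%N; last by lia.
    by rewrite natrD; lra.
  have Ek : k = r.-1 :> nat by lia.
  have [_ [_ h]] := tk'; rewrite ifT; last by lia.
  rewrite (_ : (r + s).-1.-1 = k + s.-1)%N; last by lia.
  by rewrite F2// (h Ek) us -/(psum _ _) natrD; lra.
Qed.

Lemma psum_bary n i : (0 < i < n)%N -> psum (bary n) i = i.-1%:R / 2.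
Proof.
elim: i => [//|[|i] IH] /andP[_ il].
  by rewrite psumS /psum big_ord0 coord_bary ifT ?mul0r ?addr0//; lia.
rewrite psumS IH; last by lia.
rewrite coord_bary ifT; last by lia.
rewrite /= ifF; last by lia.
by rewrite -[i.+1]addn1 natrD; lra.
Qed.

Lemma assoc_bary n : (1 < n)%N -> assoc (bary n).
Proof.
move=> n1; split.
- by rewrite coord_bary ifT//; lia.
- move=> i il; rewrite -/(psum _ _) psum_bary; last by lia.
  rewrite coord_bary ifT; last by lia.
  rewrite ifF; last by lia.
  rewrite ifF; last by lia.
  have -> : i%:R = i.-1%:R + 1 :> R by rewrite natr1 prednK//; lia.
  by have : 0 <= i.-1%:R :> R by []; lra.
- rewrite -/(psum _ _) psum_bary; last by lia.
  rewrite coord_bary ifT; last by lia.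
  rewrite ifF; last by lia.
  rewrite eqxx.
  have -> : n%:R = n.-1%:R + 1 :> R by rewrite natr1 prednK//; lia.
  have -> : n.-1%:R = n.-2%:R + 1 :> R by rewrite natr1 prednK//; lia.
  by lra.
Qed.

Lemma coord_comb n (t u : 'rV[R]_n) (a b : R) i :
  coord (a *: t + b *: u) i = a * coord t i + b * coord u i.
Proof.
by rewrite /coord; case: insub => [j|]/=; rewrite ?mxE//; lra.
Qed.

Lemma psum_comb n (t u : 'rV[R]_n) (a b : R) i :
  psum (a *: t + b *: u) i = a * psum t i + b * psum u i.
Proof.
rewrite /psum !mulr_sumr -big_split; apply: eq_bigr => j _.
exact: coord_comb.
Qed.

Lemma assoc_convex n (t u : 'rV[R]_n) (c : R) : 0 <= c <= 1 ->
  assoc t -> assoc u -> assoc ((1 - c) *: t + c *: u).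
Proof.
move=> /andP[c0 c1] [t0 tE tn] [u0 uE un]; have c1' : 0 <= 1 - c by lra.
split.
- by rewrite coord_comb t0 u0; lra.
- move=> i il; rewrite -/(psum _ _) psum_comb coord_comb.
  have /andP[p q] := tE _ il; have /andP[p' q'] := uE _ il.
  rewrite -/(psum _ _) in q; rewrite -/(psum _ _) in q'.
  apply/andP; split; first by rewrite addr_ge0// mulr_ge0.
  have := ler_wpM2l c1' q; have := ler_wpM2l c0 q'; rewrite !mulrBr.
  by rewrite !mulrBl; lra.
- rewrite -/(psum _ _) psum_comb coord_comb tn un -!/(psum _ _).
  by rewrite !mulrBr; lra.
Qed.

(* Codes for the nonempty cells of the cubic complex of K_n.  A cell which lies in
   several faces of K_n has several codes; their parametrizations differ by a
   permutation of coordinates, so they induce the same diffeology.  The empty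
   cell, having no non-empty plot, is omitted. *)
Inductive cell : nat -> Type :=
| Bary n of (1 < n)%N : cell n
| Face r s of 'I_r & cell r & cell s : cell (r + s).-1
| Join r s of 'I_r & cell r & cell s : cell (r + s).-1.

Fixpoint cell_dim n (c : cell n) : nat :=
  match c with
  | Bary _ _ => 0
  | Face _ _ _ a b => cell_dim a + cell_dim b
  | Join _ _ _ a b => cell_dim a + cell_dim b + 1
  end.

Definition join n (S : set 'rV[R]_n) (b : 'rV[R]_n) : set 'rV[R]_n :=
  [set y | exists x t, [/\ S x, 0 <= t <= 1 & y = (1 - t) *: x + t *: b]].

Fixpoint cell_set n (c : cell n) : set 'rV[R]_n :=
  match c with
  | Bary n _ => [set bary n]
  | Face r s k a b => [set face k t u | t in cell_set a & u in cell_set b]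
  | Join r s k a b =>
      join [set face k t u | t in cell_set a & u in cell_set b] (bary _)
  end.

Fixpoint cell_par n (c : cell n) : 'rV[R]_(cell_dim c) -> 'rV[R]_n :=
  match c with
  | Bary n _ => fun _ => bary n
  | Face r s k a b => fun x =>
      face k (@cell_par _ a (lsubmx x)) (@cell_par _ b (rsubmx x))
  | Join r s k a b => fun x =>
      let t := pi_set (rsubmx x 0 0) in
      let y := lsubmx x in
      (1 - t) *: face k (@cell_par _ a (lsubmx y)) (@cell_par _ b (rsubmx y))
      + t *: bary _
  end.

Arguments cell_par {n} c x.

Lemma cell_gt1 n (c : cell n) : (1 < n)%N.
Proof. by elim: c => // r s k a ? b ?; lia. Qed.

Lemma cell_sub_assoc n (c : cell n) : cell_set c `<=` @assoc n.
Proof.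
elim: c => [m m1 _ ->|r s k a IHa b IHb _ [t At [u Bu <-]]|
            r s k a IHa b IHb _ [_ [c [[t At [u Bu <-]] c01 ->]]]].
- exact: assoc_bary.
- by apply: assoc_face; rewrite ?(cell_gt1 a) ?(cell_gt1 b)//;
    [exact: IHa|exact: IHb].
- apply: assoc_convex => //.
    by apply: assoc_face; rewrite ?(cell_gt1 a) ?(cell_gt1 b)//;
      [exact: IHa|exact: IHb].
  by apply: assoc_bary; have := cell_gt1 a; have := cell_gt1 b; lia.
Qed.

Lemma pi_set01 (t : R) : 0 <= pi_set t <= 1.
Proof. by rewrite /pi_set le_max lexx ge_max ler01 ge_min lexx. Qed.

Lemma cell_par_in n (c : cell n) x : cell_set c (cell_par c x).
Proof.
elim: c x => [m m1|r s k a IHa b IHb|r s k a IHa b IHb] x //=.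
- by exists (cell_par a (lsubmx x)) => //; exists (cell_par b (rsubmx x)).
- exists (face k (cell_par a (lsubmx (lsubmx x))) (cell_par b (rsubmx (lsubmx x)))).
  exists (pi_set (rsubmx x 0 0)); split=> //; last exact: pi_set01.
  by exists (cell_par a (lsubmx (lsubmx x))) => //;
    exists (cell_par b (rsubmx (lsubmx x))).
Qed.

Definition cell_proj n (c : cell n) (x : 'rV[R]_(cell_dim c)) : cell_set c :=
  SigSub (mem_set (@cell_par_in n c x)).

Lemma cell_proj_surj n (c : cell n) (y : cell_set c) :
  exists x, cell_proj x = y.
Proof.
suff [x xy] : exists x, cell_par c x = \val y.
  by exists x; apply: val_inj.
move: (\val y) (set_valP y) => {}y.
elim: c y => [m m1|r s k a IHa b IHb|r s k a IHa b IHb] y /=.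
- by move=> ->; exists 0.
- move=> [t /IHa[v <-] [u /IHb[w <-] <-]]; exists (row_mx v w).
  by rewrite row_mxKl row_mxKr.
- move=> [_ [c [[t /IHa[v <-] [u /IHb[w <-] <-]] /andP[c0 c1] ->]]].
  exists (row_mx (row_mx v w) (const_mx c)).
  rewrite !row_mxKl !row_mxKr mxE /pi_set.
  by rewrite min_r// max_r.
Qed.

(* The diffeology for which the surjection [cell_proj c] is a subduction. *)
Definition cell_space n (c : cell n) : diffSpace R :=
  DiffSpace (pushforward (X := eucl_space R (cell_dim c)) (@cell_proj n c)).

Definition cubic_assoc n : diffSpace R :=
  DiffSpace (finest_diffeology (fun D : diffeology R (@assoc n) =>
    forall c : cell n,
      @smooth R (cell_space c) (DiffSpace D) (subfun (@cell_sub_assoc n c)))).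

Definition faceK r s (r1 : (1 < r)%N) (s1 : (1 < s)%N) (k : 'I_r)
    (t : cubic_assoc r) (u : cubic_assoc s) : cubic_assoc (r + s).-1 :=
  SigSub (mem_set (assoc_face k r1 s1 (set_valP t) (set_valP u))).

Definition baryK n (n1 : (1 < n)%N) : cubic_assoc n :=
  SigSub (mem_set (assoc_bary n1)).

End Associahedra.

Section Ainfty.
Variable R : realType.

(* Only the maps [M n] with [1 < n] matter.  All indices are in range, so the
   default value [e] of [nth] is never used. *)
Definition A_infty_form (G : diffSpace R) (e : G)
    (M : forall n, prod_space (cubic_assoc R n) (pow_space G n) -> G) :=
  (forall n, (1 < n)%N -> smooth (M n)) /\
  (forall r s (r1 : (1 < r)%N) (s1 : (1 < s)%N) (k : 'I_r)
      (t : cubic_assoc R r) (u : cubic_assoc R s) (g : (r + s).-1.-tuple G),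
    M (r + s).-1 (faceK r1 s1 k t u, g) =
    M r (t, [tuple
      if (i < k)%N then nth e g i
      else if i == k then M s (u, [tuple nth e g (k + j) | j < s])
      else nth e g (i + s.-1) | i < r])).

Definition h_unital_A_infty_form (G : diffSpace R) (e : G)
    (M : forall n, prod_space (cubic_assoc R n) (pow_space G n) -> G) :=
  [/\ A_infty_form e M,
      homotopic (fun g : G => M 2 (baryK R (ltnSn 1), [tuple e; g])) id &
      homotopic (fun g : G => M 2 (baryK R (ltnSn 1), [tuple g; e])) id].

Definition h_unital_A_infty_space (G : diffSpace R) (e : G) :=
  exists M : forall n, prod_space (cubic_assoc R n) (pow_space G n) -> G,
    h_unital_A_infty_form e M.

End Ainfty.

(* Main.v *)
Require Import Defs.
From mathcomp Require Import all_boot all_order all_algebra reals.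
From mathcomp Require Import boolp classical_sets functions.
From mathcomp Require Import topology normedtype sequences landau derive realfun exp.
From mathcomp Require Import ring lra zify.

Set Implicit Arguments.
Unset Strict Implicit.
Unset Printing Implicit Defensive.

Import Order.TTheory GRing.Theory Num.Theory numFieldNormedType.Exports.

Local Open Scope classical_set_scope.
Local Open Scope ring_scope.

(** A subdivision of [0, 1] into n intervals turns n loops into one loop, by
running through the i-th loop on the i-th interval.  Subdivisions form an
operad: a subdivision into s intervals can be shrunk into the k-th interval of
a subdivision into r intervals, and [concat_graft] says that the corresponding
concatenations of loops compose in the same way.  So the A-infinity form only
asks for a map [cuts] from each K_n to the subdivisions into n intervals which
takes faces to operadic composites ([cuts_face]) and is smooth on every cell
([smooth_cuts]).

Such a map is built by induction on n.  On the boundary of K_n it is imposed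
by the faces; since subdivisions form a convex set, it extends over the cone on
the boundary by sliding towards the even subdivision, which is the value at the
cone point.  The slide is reparametrized by [step], a smooth function equal to
0 on the negative axis and to 1 beyond 1.  Hence [step (pi_set t) = step t], so
the extension is smooth in the parameters of the cells although the
parametrizations of the cells are not.

The induction is consistent because all faces through a boundary point impose
the same subdivision there.  A face corresponds to a block of
consecutive indices, and two blocks seen in one point are nested or disjoint,
never crossing.  In both cases the point is an iterated face in two ways, and
the associativity of faces and that of subdivisions match by induction
([graft_face_wlog], [subdiv_coherent]).

It remains to see that a concatenation of loops depends smoothly on everything
([plot_concat]), and only this uses reflexivity.  Near a junction two plots P1
and P2 are glued, and at each point one of them has the value a.  Hence
phi o P = phi o P1 + phi o P2 - phi(a) for every smooth real function phi near a,
so phi o P is smooth, and reflexivity makes P a plot ([plot_glue]).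

Finally a loop multiplied with the constant loop, on either side, is an affine
reparametrization of the loop, and the segment from this affine map to the
identity gives the homotopies required of the unit ([affine_homotopic]). *)

(** * Smooth functions of one real variable *)

Section Line.
Variable R : realType.

Lemma differentiable_line (f : R -> R) (x : 'rV[R]_1) (a : R) :
  is_derive (x 0 0) 1 f a ->
  differentiable (fun y : 'rV[R]_1 => f (y 0 0)) x /\
  'D_(delta_mx 0 0) (fun y : 'rV[R]_1 => f (y 0 0)) x = a.
Proof.
move=> df; have dfd : differentiable f (x 0 0).
  by apply/derivable1_diffP; have [] := df.
have dc : differentiable (fun y : 'rV[R]_1 => y 0 0 : R) x.
  exact: differentiable_coord.
have dcomp := differentiable_comp dc dfd; split=> //.
rewrite (_ : (fun y : 'rV[R]_1 => f (y 0 0)) = f \o (fun y => y 0 0 : R))//.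
rewrite deriveE// diff_comp//= -(deriveE _ dc).
have -> : 'D_(delta_mx 0 0) (fun y : 'rV[R]_1 => y 0 0 : R) x = 1.
  by rewrite (@derive_coord _ _ _ id)// derive_id mxE !eqxx.
by rewrite -deriveE//; have [_ ->] := df.
Qed.

(** This gives the derivative of [flat n] at 0, the only point where the rules of
calculus do not apply. *)
Lemma is_derive_flat (f : R -> R) (C : R) :
  f 0 = 0 -> (forall x, `|f x| <= C * x ^+ 2) -> is_derive (0 : R) 1 f 0.
Proof.
move=> f0 fC.
have H : h^-1 *: ((f \o shift 0) (h *: 1) - f 0) @[h --> 0^'] --> (0 : R).
  apply/cvgr0Pnorm_le => e e0.
  have C0 : 0 <= C by have := fC 1; rewrite expr1n mulr1; apply: le_trans.
  have : \forall h \near (0 : R)^', `|h| <= e / (C + 1).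
    apply: dnbhs0_le; rewrite divr_gt0//; lra.
  apply: filterS => h he.
  rewrite /= f0 subr0 addr0 [_ *: 1]mulr1 /GRing.scale /= normrM normfV.
  have [->|h0] := eqVneq h 0; first by rewrite f0 normr0 mulr0 ltW.
  rewrite ler_pdivrMl ?normr_gt0// (le_trans (fC h))// -real_normK ?num_real//.
  rewrite expr2 mulrA mulrC ler_wpM2l//.
  move: he; rewrite ler_pdivlMr; last by lra.
  have := normr_ge0 h; nra.
by apply: DeriveDef; [apply/cvg_ex; exists 0|apply: cvg_lim].
Qed.


(** If the derivative of each member of a sequence is a fixed kind of linear
combination of the two next ones, no derivative ever leaves the span of the
sequence, so all members are smooth.  The powers of 1/x and the functions
[flat n] below have this form. *)
Lemma smooth_ladder (U : set R) (F : nat -> R -> R) (b : nat -> R) (d : R) :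
  open U ->
  (forall n x, U x ->
     is_derive x 1 (F n) (b n * F n.+1 x + d * F n.+2 x)) ->
  forall n, smooth_fun [set x : 'rV[R]_1 | U (x 0 0)] (fun x => F n (x 0 0)).
Proof.
move=> oU dF n; have oU' : open [set x : 'rV[R]_1 | U (x 0 0)].
  by apply: open_comp oU => x _; exact: coord_continuous.
have diffF m (x : 'rV[R]_1) (Ux : U (x 0 0)) := differentiable_line (dF m _ Ux).
apply/smooth_funP => k; elim: k n => [|k IH] n.
  by case=> // _ x Ux; have [] := diffF n x Ux.
apply/smooth_uptoS; split=> [x Ux|i]; first by have [] := diffF n x Ux.
rewrite (ord1 i).
pose G m : 'rV[R]_1 -> R := fun x => F m (x 0 0).
apply: (@smooth_upto_ext _ _ _ _ (cst (b n) * G n.+1 + cst d * G n.+2)%R) => //.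
  by move=> x; rewrite inE => Ux; have [_ ->] := diffF n x Ux.
by apply: smooth_upto_add => //; apply: smooth_upto_mul => //;
  [exact: smooth_upto_cst|exact: IH|exact: smooth_upto_cst|exact: IH].
Qed.

Lemma is_derive_invX n (x : R) : x != 0 ->
  is_derive x 1 (fun y : R => y^-1 ^+ n) (- n%:R * x^-1 ^+ n.+1).
Proof.
move=> x0; rewrite (_ : (fun y => _) = horner 'X^n \o (fun y : R => y^-1)).
  have := is_derive_poly 'X^n x^-1; rewrite derivXn => dX.
  have dI : is_derive x 1 (fun y : R => y^-1) _ := is_deriveV x0 (is_derive_id x 1).
  apply: is_derive_eq; rewrite hornerMn hornerXn /GRing.scale /= mulr1 -exprVn mulNr mulrN.
  by case: n {dX} => [|n]; rewrite ?mulr0n ?mul0r//= -mulr_natl !exprS; ring.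
by apply/funext => y /=; rewrite hornerXn.
Qed.

Lemma smooth_fun_inv1 : smooth_fun [set x : 'rV[R]_1 | x 0 0 != 0] (fun x => (x 0 0)^-1).
Proof.
have H n (x : R) : x != 0 -> is_derive x 1 (fun x : R => x^-1 ^+ n.+1)
    (- n.+1%:R * x^-1 ^+ n.+2 + 0 * x^-1 ^+ n.+3).
  by rewrite mul0r addr0; exact: is_derive_invX.
exact: (@smooth_ladder _ (fun n x => x^-1 ^+ n.+1) _ _ (@open_neq _ 0) H 0%N).
Qed.

(** The functions x^(-n) exp(-1/x), extended by 0; for n = 0 this is the usual
smooth function vanishing exactly on the negative half-line. *)
Definition flat n (x : R) := if 0 < x then x^-1 ^+ n * expR (- x^-1) else 0.

(** Put y = 1/x in y^(n+2)/(n+2)! <= exp y, one term of the exponential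
series. *)
Lemma flat_le n (x : R) : `|flat n x| <= n.+2`!%:R * x ^+ 2.
Proof.
rewrite /flat; case: ltP => [x0|_]; last by rewrite normr0 mulr_ge0// sqr_ge0.
have y0 : 0 < x^-1 by rewrite invr_gt0.
rewrite ger0_norm; last by rewrite mulr_ge0 ?expR_ge0// exprn_ge0// ltW.
have f0 : 0 < n.+2`!%:R :> R by rewrite ltr0n fact_gt0.
have h : x^-1 ^+ n.+2 <= n.+2`!%:R * expR x^-1.
  rewrite -ler_pdivrMl//; apply: le_trans (expR_ge1Dxn n.+1 (ltW y0)).
  by rewrite mulrC; lra.
have -> : x^-1 ^+ n = x ^+ 2 * x^-1 ^+ n.+2.
  by rewrite -[n.+2]addn2 exprD mulrCA -exprMn divff ?gt_eqF// expr1n mulr1.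
rewrite -mulrA [_ * x ^+ 2]mulrC ler_wpM2l ?sqr_ge0//.
by rewrite expRN ler_pdivrMr ?expR_gt0.
Qed.

Lemma is_derive_flatn n (x : R) :
  is_derive x 1 (flat n) (- n%:R * flat n.+1 x + 1 * flat n.+2 x).
Proof.
have [x0|x0|->] := ltgtP x 0.
- rewrite {2 3}/flat ltNge ltW//= !mulr0 addr0.
  apply: near_eq_is_derive (is_derive_cst 0 x 1).
  have : nbhs x [set y | y < 0] by apply: open_nbhs_nbhs; split=> //; exact: open_lt.
  by apply: filterS => y y0; rewrite /flat ltNge ltW.
- rewrite {2 3}/flat x0.
  apply: (@near_eq_is_derive _ _ _ (fun y : R => y^-1 ^+ n * expR (- y^-1))).
    have : nbhs x [set y | 0 < y] by apply: open_nbhs_nbhs; split=> //; exact: open_gt.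
    by apply: filterS => y y0; rewrite /flat ifT.
  have xn : x != 0 by rewrite gt_eqF.
  have dX := is_derive_invX n xn.
  have dI : is_derive x 1 (fun y : R => y^-1) _ := is_deriveV xn (is_derive_id x 1).
  have dN : is_derive x 1 (fun y : R => - y^-1) _ := is_deriveN dI.
  have dE := @is_derive1_comp _ expR (fun y => - y^-1) x _ _ (is_derive_expR _) dN.
  apply: is_derive_eq (is_deriveM dX dE) _.
  by rewrite /GRing.scale /= !exprS expr0; field.
- by rewrite {2 3}/flat ltxx !mulr0 addr0; apply: is_derive_flat (flat_le n); rewrite /flat ltxx.
Qed.

Lemma smooth_fun_flat : smooth_fun setT (fun x : 'rV[R]_1 => flat 0 (x 0 0)).
Proof. by apply: (@smooth_ladder setT flat _ _ openT _ 0%N) => n x _; exact: is_derive_flatn. Qed.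

Lemma smooth_fun_comp1 m (U : set 'rV[R]_m) (V : set R) (g : R -> R) f :
  open U -> (forall x, U x -> V (f x)) ->
  smooth_fun [set x : 'rV[R]_1 | V (x 0 0)] (fun x => g (x 0 0)) ->
  smooth_fun U f -> smooth_fun U (fun x => g (f x)).
Proof.
move=> oU fV sg sf; pose h x : 'rV[R]_1 := const_mx (f x).
have sh : smooth_map U h.
  by move=> j; apply: smooth_fun_ext sf => // x _; rewrite mxE.
have hV : h @` U `<=` [set x : 'rV[R]_1 | V (x 0 0)].
  by move=> _ [x Ux <-]; rewrite /= mxE; exact: fV.
apply: (smooth_fun_ext oU _ (smooth_fun_comp oU hV sh sg)) => x _.
by rewrite /= mxE.
Qed.

Lemma smooth_funD m (U : set 'rV[R]_m) f g : open U ->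
  smooth_fun U f -> smooth_fun U g -> smooth_fun U (fun x => f x + g x).
Proof.
move=> oU /smooth_funP sf /smooth_funP sg; apply/smooth_funP => k.
exact: (smooth_upto_add oU (sf k) (sg k)).
Qed.

Lemma smooth_funM m (U : set 'rV[R]_m) f g : open U ->
  smooth_fun U f -> smooth_fun U g -> smooth_fun U (fun x => f x * g x).
Proof.
move=> oU /smooth_funP sf /smooth_funP sg; apply/smooth_funP => k.
exact: (smooth_upto_mul oU (sf k) (sg k)).
Qed.

Lemma smooth_funB m (U : set 'rV[R]_m) f g : open U ->
  smooth_fun U f -> smooth_fun U g -> smooth_fun U (fun x => f x - g x).
Proof.
move=> oU sf sg; apply: (smooth_fun_ext oU _ (smooth_funD oU sf
  (smooth_funM oU (@smooth_fun_cst _ _ U (-1)) sg))) => x _.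
by rewrite mulN1r.
Qed.

Lemma smooth_funV m (U : set 'rV[R]_m) f : open U -> (forall x, U x -> f x != 0) ->
  smooth_fun U f -> smooth_fun U (fun x => (f x)^-1).
Proof.
move=> oU f0 sf.
exact: (@smooth_fun_comp1 _ U [set y | y != 0] (@GRing.inv R) _ oU f0 smooth_fun_inv1 sf).
Qed.

Definition step (t : R) := flat 0 t / (flat 0 t + flat 0 (1 - t)).

Lemma flat_gt0 (t : R) : 0 < t -> 0 < flat 0 t.
Proof. by move=> t0; rewrite /flat t0 mul1r expR_gt0. Qed.

Lemma flat_le0 (t : R) : t <= 0 -> flat 0 t = 0.
Proof. by rewrite /flat ltNge => ->. Qed.

Lemma flat_ge0 (t : R) : 0 <= flat 0 t.
Proof. by have [/flat_gt0/ltW|/flat_le0->] := ltP 0 t. Qed.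

Lemma step_den_gt0 (t : R) : 0 < flat 0 t + flat 0 (1 - t).
Proof.
have h1 := flat_ge0 t; have h2 := flat_ge0 (1 - t).
have [/flat_gt0 h|t0] := ltP 0 t; first lra.
have /flat_gt0 h : 0 < 1 - t by lra.
lra.
Qed.

Lemma step_le0 t : t <= 0 -> step t = 0.
Proof. by move=> t0; rewrite /step flat_le0 ?mul0r. Qed.

Lemma step_ge1 t : 1 <= t -> step t = 1.
Proof.
move=> t1; rewrite /step [flat 0 (1 - t)]flat_le0 ?subr_le0//.
by rewrite addr0 divff// gt_eqF// flat_gt0// (lt_le_trans ltr01).
Qed.

Lemma step01 t : 0 <= step t <= 1.
Proof.
have h := step_den_gt0 t; have := flat_ge0 t; have := flat_ge0 (1 - t) => h1 h2.
by rewrite /step divr_ge0 ?(ltW h)//= ler_pdivrMr// mul1r lerDl.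
Qed.

(** This absorbs the corners of the cell parametrizations. *)
Lemma step_pi_set t : step (pi_set t) = step t.
Proof.
rewrite /pi_set; have [t1|t1] := leP 1 t.
  by rewrite max_r// !step_ge1.
by have [t0|t0] := leP 0 t; rewrite // !step_le0// ltW.
Qed.

Lemma smooth_fun_step m (U : set 'rV[R]_m) f : open U ->
  smooth_fun U f -> smooth_fun U (fun x => step (f x)).
Proof.
move=> oU sf.
have sflat g : smooth_fun U g -> smooth_fun U (fun x => flat 0 (g x)).
  by move=> sg; exact: (smooth_fun_comp1 (V := setT) oU _ smooth_fun_flat sg).
have s1 := smooth_funB oU (@smooth_fun_cst _ _ U 1) sf.
apply: smooth_funM (sflat _ sf) _ => //; apply: smooth_funV => //.
  by move=> x _; rewrite gt_eqF// step_den_gt0.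
exact: smooth_funD oU (sflat _ sf) (sflat _ s1).
Qed.

End Line.

(** * Faces and subdivisions by partial sums *)

Ltac decide_ifs := repeat match goal with
  | |- context [if ?b then _ else _] =>
      first [have -> : b = true by lia | have -> : b = false by lia]
  end.

Section Breakpoints.
Variable R : realType.
Implicit Types F T G V S Q : nat -> R.

(** A point t of K_n is encoded by its partial sums F i = t_1 + ... + t_i, a
function defined for all i and constant from n on.  This removes the dimension
from types, so that iterated faces can be compared by plain equality, and it
makes faces and operadic composites of subdivisions look alike. *)
Definition assocF n F :=
  [/\ F 0%N = 0, forall i, F i <= F i.+1,
      forall i, (i < n)%N -> F i.+1 <= i%:R &
      forall i, (n <= i)%N -> F i = n.-1%:R].

Definition faceF k s T G i :=
  if (i <= k)%N then T i
  else if (i < k + s)%N then T k + G (i - k)%N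
  else T (i - s.-1)%N + s.-1%:R.

Definition baryF n i : R := if (i < n)%N then i.-1%:R / 2 else n.-1%:R.

(** A subdivision is encoded by its division points S 0 = 0 < ... < S n = 1, that
is, by the partial sums of the lengths of its intervals. *)
Definition weights n S :=
  [/\ S 0%N = 0, S n = 1 & forall i, (i < n)%N -> S i < S i.+1].

(** Operadic composition of subdivisions: the k-th interval of S, counted from
0, is subdivided in the proportions of Q. *)
Definition graftF k s S Q i :=
  if (i <= k)%N then S i
  else if (i <= k + s)%N then S k + (S k.+1 - S k) * Q (i - k)%N
  else S (i - s.-1)%N.

Definition evenF n i : R := i%:R / n%:R.

Definition coneF (t : R) F G i := (1 - t) * F i + t * G i.

(** The two associativity laws of faces; the same two laws hold for [graftF]. *)
Lemma faceF_nested k l s v T V G : (l < v)%N -> (1 < s)%N -> V 0%N = 0 ->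
  faceF k (v + s).-1 T (faceF l s V G) = faceF (k + l) s (faceF k v T V) G.
Proof.
move=> lv s1 V0; apply/funext => i; rewrite /faceF.
have [ik|ki] := leqP i k; first by decide_ifs.
have [ikl|kli] := leqP i (k + l); first by decide_ifs.
have [j Ej] : {j | i = (k + l + j)%N} by exists (i - (k + l))%N; lia.
have [js|sj] := ltnP j s.
  decide_ifs; rewrite (_ : i - k - l = i - (k + l))%N; last lia.
  have [->|l0] := posnP l; first by rewrite addn0 leqnn V0 add0r.
  by decide_ifs; rewrite addKn addrA.
have [vi|iv] := ltnP i (k + (v + s).-1).
  decide_ifs; rewrite (_ : i - s.-1 - k = i - k - s.-1)%N; last lia.
  by rewrite addrA.
decide_ifs; rewrite (_ : i - s.-1 - v.-1 = i - (v + s).-1.-1)%N; last lia.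
by rewrite -addrA -natrD; congr (_ + _%:R); lia.
Qed.

Lemma faceF_disjoint k l s s' T G G' : (k < l)%N -> (1 < s)%N -> (1 < s')%N ->
  faceF (l + s.-1) s' (faceF k s T G) G' = faceF k s (faceF l s' T G') G.
Proof.
move=> kl s1 s'1; apply/funext => i; rewrite /faceF.
have [ik|ki] := leqP i k; first by decide_ifs.
have [iks|ksi] := ltnP i (k + s); first by decide_ifs.
have [il|li] := leqP i (l + s.-1); first by decide_ifs.
have [ils|sli] := ltnP i (l + s.-1 + s').
  decide_ifs; rewrite addnK (_ : i - s.-1 - l = i - (l + s.-1))%N; last lia.
  by rewrite addrAC.
decide_ifs; rewrite (_ : i - s'.-1 - s.-1 = i - s.-1 - s'.-1)%N; last lia.
by rewrite addrAC.
Qed.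

Lemma graftF_nested k l s v S V Q : (l < v)%N -> (1 < s)%N -> V 0%N = 0 ->
  graftF k (v + s).-1 S (graftF l s V Q) = graftF (k + l) s (graftF k v S V) Q.
Proof.
move=> lv s1 V0; apply/funext => i; rewrite /graftF.
have [ik|ki] := leqP i k; first by decide_ifs.
have [ikl|kli] := leqP i (k + l); first by decide_ifs.
have [js|sj] := leqP i (k + l + s).
  decide_ifs; rewrite (_ : i - k - l = i - (k + l))%N; last lia.
  rewrite (_ : (k + l).+1 - k = l.+1)%N; last lia.
  have [->|l0] := posnP l; first by rewrite addn0 leqnn V0; ring.
  by decide_ifs; rewrite addKn; ring.
have [vi|iv] := leqP i (k + (v + s).-1).
  by decide_ifs; rewrite (_ : i - s.-1 - k = i - k - s.-1)%N; last lia.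
by decide_ifs; rewrite (_ : i - s.-1 - v.-1 = i - (v + s).-1.-1)%N; last lia.
Qed.

Lemma graftF_disjoint k l s s' S Q Q' : (k < l)%N -> (1 < s)%N -> (1 < s')%N ->
  Q s = 1 ->
  graftF (l + s.-1) s' (graftF k s S Q) Q' = graftF k s (graftF l s' S Q') Q.
Proof.
move=> kl s1 s'1 Qs; apply/funext => i; rewrite /graftF.
have [ik|ki] := leqP i k; first by decide_ifs.
have [iks|ksi] := leqP i (k + s); first by decide_ifs.
have [il|li] := leqP i (l + s.-1); first by decide_ifs.
have [ils|sli] := leqP i (l + s.-1 + s'); last first.
  by decide_ifs; rewrite (_ : i - s'.-1 - s.-1 = i - s.-1 - s'.-1)%N; last lia.
rewrite [in RHS](_ : i - s.-1 <= l = false)%N; last lia.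
rewrite [in RHS](_ : i - s.-1 <= l + s' = true)%N; last lia.
decide_ifs; rewrite (_ : i - s.-1 - l = i - (l + s.-1))%N; last lia.
rewrite (_ : (l + s.-1).+1 - s.-1 = l.+1)%N; last lia.
have [lk|kl'] := leqP (l + s.-1) (k + s); last by rewrite addnK.
have -> : l = k.+1 by lia.
rewrite (_ : k.+1 + s.-1 - k = s)%N; last lia.
by rewrite Qs; ring.
Qed.

Lemma graftF_weights r s k S Q : (1 < r)%N -> (1 < s)%N -> (k < r)%N ->
  weights r S -> weights s Q -> weights (r + s).-1 (graftF k s S Q).
Proof.
move=> r1 s1 kr [S0 Sr Si] [Q0 Qs Qi]; rewrite /graftF; split.
- by [].
- have [krs|krs] := leqP (r + s).-1 (k + s).
    decide_ifs; have Ek : r = k.+1 by lia.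
    rewrite (_ : (r + s).-1 - k = s)%N; last lia.
    by rewrite Qs -Ek Sr; ring.
  by decide_ifs; rewrite (_ : (r + s).-1 - s.-1 = r)%N//; lia.
- move=> i ilt; have d0 : 0 < S k.+1 - S k by rewrite subr_gt0 Si.
  have [ik|ki] := ltnP i k; first by decide_ifs; apply: Si; lia.
  have [iks|ksi] := ltnP i (k + s).
    have E : (if (i <= k)%N then S i else S k + (S k.+1 - S k) * Q (i - k)%N)
        = S k + (S k.+1 - S k) * Q (i - k)%N.
      case: leqP => // ik; have -> : i = k by lia.
      by rewrite subnn Q0; ring.
    decide_ifs; rewrite (_ : (if (i <= k)%N then S i else _) = S k + (S k.+1 - S k) * Q (i - k)%N).
      by rewrite ltrD2l ltr_pM2l// subSn//; apply: Qi; lia.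
    by rewrite -[RHS]E; decide_ifs.
  rewrite /=.
  rewrite (_ : (i <= k)%N = false); last lia.
  have [ik|ik] := leqP i (k + s).
    have -> : i = (k + s)%N by lia.
    rewrite addKn Qs mulr1 addrC subrK (_ : (k + s).+1 - s.-1 = k.+2)%N; last lia.
    by apply: Si; lia.
  rewrite subSn; last lia.
  by apply: Si; lia.
Qed.

Lemma evenF_weights n : (0 < n)%N -> weights n (evenF n).
Proof.
move=> n0; have n0' : 0 < n%:R :> R by rewrite ltr0n.
rewrite /evenF; split; first by rewrite mul0r.
- by rewrite divff// gt_eqF.
- by move=> i _; rewrite ltr_pM2r ?invr_gt0// ltr_nat.
Qed.

Lemma coneF_weights n t S Q : 0 <= t <= 1 ->
  weights n S -> weights n Q -> weights n (coneF t S Q).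
Proof.
move=> /andP[t0 t1] [S0 Sn Si] [Q0 Qn Qi]; rewrite /coneF; split.
- by rewrite S0 Q0; ring.
- by rewrite Sn Qn; ring.
- move=> i /[dup] /Si hS /Qi hQ.
  have [t2|t2] := leP t (1 / 2); last first.
    have : 0 <= (1 - t) * (S i.+1 - S i) by rewrite mulr_ge0; lra.
    have : 0 < t * (Q i.+1 - Q i) by rewrite mulr_gt0; lra.
    lra.
  have : 0 < (1 - t) * (S i.+1 - S i) by rewrite mulr_gt0; lra.
  have : 0 <= t * (Q i.+1 - Q i) by rewrite mulr_ge0; lra.
  lra.
Qed.

(** The image of the face with indices k and s, cut out of K_n by conditions on
the increments of F from k on: they satisfy the bounds of a point of K_s before
k + s, and at k + s they reach the total s - 1 of such a point. *)
Definition block n k s F :=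
  [/\ (1 < s < n)%N, (k + s <= n)%N,
      forall i, (0 < i < s)%N -> F (k + i)%N - F k <= i.-1%:R &
      s.-1%:R <= F (k + s)%N - F k].

Lemma faceF_assocF r s k T G : (1 < r)%N -> (1 < s)%N -> (k < r)%N ->
  assocF r T -> assocF s G -> assocF (r + s).-1 (faceF k s T G).
Proof.
move=> r1 s1 kr [T0 Tm Tb Te] [G0 Gm Gb Ge]; rewrite /faceF.
have Tk : T k <= k%:R.
  case: (posnP k) => [->|k0]; first by rewrite T0.
  rewrite -[k]prednK// (le_trans (Tb _ _)) ?ler_nat//; lia.
split=> //.
- move=> i; have [ik|ki] := ltnP i k; first by decide_ifs.
  have [iks|ksi] := ltnP i.+1 (k + s).
    decide_ifs; have [ik|ki'] := leqP i k.
      have -> : i = k by lia.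
      rewrite subSnn; have := Gm 0%N; rewrite G0; lra.
    by rewrite lerD2l subSn//.
  decide_ifs; have [iks|ksi'] := ltnP i (k + s).
    have -> : i = (k + s).-1 by lia.
    rewrite (_ : (k + s).-1.+1 - s.-1 = k.+1)%N; last lia.
    decide_ifs; rewrite (_ : (k + s).-1 - k = s.-1)%N; last lia.
    have := Gm s.-1; rewrite prednK; last lia.
    by rewrite (Ge s)// => Gs; rewrite lerD.
  decide_ifs.
  by rewrite lerD2r subSn//; lia.
- move=> i ilt; have [ik|ki] := ltnP i k; first by decide_ifs; apply: Tb; lia.
  have [iks|ksi] := ltnP i.+1 (k + s).
    have Gi : G (i - k).+1 <= (i - k)%:R by apply: Gb; lia.
    decide_ifs; rewrite subSn// (le_trans (lerD Tk Gi))//.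
    by rewrite -natrD ler_nat; lia.
  decide_ifs; rewrite (_ : i.+1 - s.-1 = (i - s.-1).+1)%N; last lia.
  have /Tb : (i - s.-1 < r)%N by lia.
  rewrite -(lerD2r s.-1%:R) => /le_trans; apply; rewrite -natrD ler_nat; lia.
- move=> i ilt; decide_ifs; rewrite Te; last lia.
  by rewrite -natrD; congr (_%:R); lia.
Qed.

Lemma faceF_block r s k T G : (1 < r)%N -> (1 < s)%N -> (k < r)%N ->
  assocF r T -> assocF s G -> block (r + s).-1 k s (faceF k s T G).
Proof.
move=> r1 s1 kr [T0 Tm Tb Te] [G0 Gm Gb Ge]; rewrite /block /faceF leqnn; split.
- lia.
- lia.
- move=> i /andP[i0 ils]; decide_ifs; rewrite addKn addrC addKr.
  by rewrite -{1}[i]prednK// Gb//; lia.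
- decide_ifs; rewrite (_ : k + s - s.-1 = k.+1)%N; last lia.
  have := Tm k; lra.
Qed.

(** The face coordinates can be read off: G is F along the block, truncated at
its last value s - 1, and T is F with the block removed. *)
Lemma block_faceF n s k F : assocF n F -> block n k s F ->
  exists T G, [/\ assocF (n - s.-1) T, assocF s G & F = faceF k s T G].
Proof.
move=> [F0 Fm Fb Fe] [/andP[s1 sn] ksn Bi Bs].
have mono i j : (i <= j)%N -> F i <= F j by exact: homo_leq (@lexx _ _) (@le_trans _ _) Fm _ _.
exists (fun i => if (i <= k)%N then F i else F (i + s.-1)%N - s.-1%:R).
exists (fun i => if (i < s)%N then F (k + i)%N - F k else s.-1%:R); split.
- split=> //.
  + move=> i; have [ik|ki] := ltnP i k; first by decide_ifs.
    decide_ifs; have [ik|ki'] := leqP i k.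
      have -> : i = k by lia.
      rewrite (_ : k.+1 + s.-1 = k + s)%N; last lia.
      lra.
    by rewrite lerD2r; apply: mono; lia.
  + move=> i ilt; have [ik|ki] := ltnP i k; first by decide_ifs; apply: Fb; lia.
    decide_ifs; rewrite lerBlDr -natrD addSn; apply: Fb; lia.
  + move=> i ilt; decide_ifs; rewrite Fe; last lia.
    have -> : n.-1%:R = (n - s.-1).-1%:R + s.-1%:R :> R.
      by rewrite -natrD; congr (_%:R); lia.
    by rewrite addrK.
- split=> //.
  + by rewrite ifT ?addn0 ?subrr//; lia.
  + move=> i; have [ils|sli] := ltnP i.+1 s.
      by decide_ifs; rewrite lerD2r; apply: mono; lia.
    case: ifP => // ils; have [->|i0] := posnP i; first by rewrite addn0 subrr.
    by rewrite (le_trans (Bi _ _)) ?ler_nat ?i0//; lia.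
  + move=> i ilt; case: ifP => ils; first exact: Bi.
    by rewrite ler_nat; lia.
  + by move=> i ilt; decide_ifs.
- apply/funext => i; rewrite /faceF leqnn /=; have [ik|ki] := leqP i k; first by decide_ifs.
  have [iks|ksi] := ltnP i (k + s).
    decide_ifs.
    by rewrite subnKC ?(ltnW ki)// addrC subrK.
  decide_ifs; rewrite subrK; congr F; lia.
Qed.

Lemma faceF_inj r s k T G T' G' : (1 < s)%N ->
  assocF r T -> assocF s G -> assocF r T' -> assocF s G' ->
  faceF k s T G = faceF k s T' G' -> T = T' /\ G = G'.
Proof.
move=> s1 [T0 Tm Tb Te] [G0 Gm Gb Ge] [T'0 T'm T'b T'e] [G'0 G'm G'b G'e] E.
have ET : T = T'.
  apply/funext => i; have [ik|ki] := leqP i k.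
    by have := congr1 (@^~ i) E; rewrite /= /faceF ik.
  have := congr1 (@^~ (i + s.-1)%N) E; rewrite /= /faceF.
  by decide_ifs; rewrite addnK => /addIr.
split=> //; apply/funext => i; have [ils|sli] := ltnP i s; last by rewrite Ge ?G'e.
have [->|i0] := posnP i; first by rewrite G0 G'0.
have := congr1 (@^~ (k + i)%N) E; rewrite /= /faceF.
by decide_ifs; rewrite addKn -ET => /addrI.
Qed.

End Breakpoints.

(** * Subdivisions indexed by the associahedra *)

Section Subdivision.
Variable R : realType.
Implicit Types F T G : nat -> R.

(** A boundary point makes one of the inequalities defining K_n an equality: its
k-th coordinate, counted from 0, vanishes if k > 0, and its s-th partial sum is
maximal if k = 0.  That inequality has a positive defect d at the cone point, so
its defect is t d at height t over such a boundary point, and at least t' d at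
height t' over any point of K_n. *)
Lemma cone_boundary_le n k s F F' (t t' : R) :
  block n k s F -> assocF n F -> assocF n F' -> t' <= 1 ->
  coneF t F (baryF R n) = coneF t' F' (baryF R n) -> t' <= t.
Proof.
move=> [/andP[s1 sn] ksn Bi Bs] [F0 Fm Fb Fe] [F'0 F'm F'b F'e] t'1 E.
have Ei i : coneF t F (baryF R n) i = coneF t' F' (baryF R n) i by rewrite E.
have [k0|k0] := posnP k.
  subst k; have := Ei s; rewrite /coneF /baryF sn.
  rewrite add0n F0 subr0 in Bs.
  have := F'b s.-1 ltac:(lia); have := Fb s.-1 ltac:(lia); rewrite prednK; last lia.
  move=> Fs F's; have s0 : 0 < s.-1%:R :> R by rewrite ltr0n; lia.
  have -> : F s = s.-1%:R by apply/eqP; rewrite eq_le Fs Bs.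
  move=> {}E; have : (1 - t') * F' s <= (1 - t') * s.-1%:R by rewrite ler_wpM2l; lra.
  move=> h; have : s.-1%:R * t' <= s.-1%:R * t by lra.
  by rewrite ler_pM2l.
have := Ei k; have := Ei k.+1; rewrite /coneF /baryF.
decide_ifs; have -> : k.+1.-1%:R = k.-1%:R + 1 :> R by rewrite natr1 prednK.
have := Bi 1%N ltac:(lia); rewrite addn1 /= mulr0n => Fk E1 E2.
have := Fm k; have := F'm k => h1 h2.
have {h2}Fk' : F k.+1 = F k by lra.
rewrite Fk' in E1.
have : 0 <= (1 - t') * (F' k.+1 - F' k) by rewrite mulr_ge0; lra.
lra.
Qed.

Lemma cone_boundary_inj n k s k' s' F F' (t t' : R) :
  block n k s F -> block n k' s' F' -> assocF n F -> assocF n F' ->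
  t <= 1 -> t' <= 1 ->
  coneF t F (baryF R n) = coneF t' F' (baryF R n) -> t = t' /\ (t < 1 -> F = F').
Proof.
move=> B B' AF AF' t1 t1' E; have Ett : t = t'.
  apply/eqP; rewrite eq_le.
  by rewrite (cone_boundary_le B AF AF' t1' E) (cone_boundary_le B' AF' AF t1 (esym E)).
split=> // tlt; apply/funext => i; have := congr1 (@^~ i) E.
by rewrite /coneF -Ett => /addIr /mulfI; apply; rewrite subr_eq0 gt_eqF.
Qed.

(** A description of a point of K_n as a point of height [ct] in the cone over
the face [ck] of K_[cr] x K_[cs], at the point ([cT], [cG]) of this product. *)
Record conept := ConePt {
  cr : nat; cs : nat; ck : nat; cT : nat -> R; cG : nat -> R; ct : R }.

Definition cone_at n X (d : conept) :=
  [/\ [/\ (1 < cr d)%N, (1 < cs d)%N, (ck d < cr d)%N & n = (cr d + cs d).-1],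
      assocF (cr d) (cT d), assocF (cs d) (cG d), 0 <= ct d <= 1 &
      X = coneF (ct d) (faceF (ck d) (cs d) (cT d) (cG d)) (baryF R n)].

Definition cone_val (A : nat -> (nat -> R) -> nat -> R) n (d : conept) :=
  coneF (step (ct d))
    (graftF (ck d) (cs d) (A (cr d) (cT d)) (A (cs d) (cG d))) (evenF R n).

(** One step of the induction.  The description of X is chosen arbitrarily; that
the value does not depend on it is [subdiv_coherent]. *)
Definition cone_extend A n X :=
  match pselect (exists d, cone_at n X d) with
  | left H => cone_val A n (projT1 (cid H))
  | right _ => evenF R n
  end.

(** The table of the values for all arities below N; [subdiv] is its diagonal,
which satisfies the recursive equation [subdivE]. *)
Fixpoint subdiv_upto N n (X : nat -> R) : nat -> R :=
  if N is N'.+1 then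
    if (n < N')%N then subdiv_upto N' n X else cone_extend (subdiv_upto N') n X
  else evenF R n.

Definition subdiv n := subdiv_upto n.+1 n.

Lemma subdivE n X : subdiv n X = cone_extend subdiv n X.
Proof.
rewrite {1}/subdiv /= ltnn.
have H N m Y : (m < N)%N -> subdiv_upto N m Y = subdiv m Y.
  elim: N => // N IH mN /=; case: ltnP => [/IH//|Nm].
  have -> : m = N by lia.
  by rewrite /subdiv /= ltnn.
rewrite /cone_extend; case: pselect => // h; case: cid => d [[r1 s1 kr nE] _ _ _ _] /=.
by rewrite /cone_val !H//; clear H h; lia.
Qed.

Lemma subdiv_weights n X : (0 < n)%N -> weights n (subdiv n X).
Proof.
elim/ltn_ind: n X => n IH X n0; rewrite subdivE /cone_extend.
case: pselect => [h|_]; last exact: evenF_weights.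
case: cid => -[r s k T G t] [/= [r1 s1 kr nE] _ _ _ _].
apply: coneF_weights (step01 _) _ (evenF_weights _ n0) => /=.
by rewrite nE; apply: graftF_weights => //; apply: IH; lia.
Qed.

Definition coherent n := forall X d, cone_at n X d -> subdiv n X = cone_val subdiv n d.

Lemma coherent_face r s k T G : coherent (r + s).-1 ->
  (1 < r)%N -> (1 < s)%N -> (k < r)%N -> assocF r T -> assocF s G ->
  subdiv (r + s).-1 (faceF k s T G) = graftF k s (subdiv r T) (subdiv s G).
Proof.
move=> coh r1 s1 kr AT AG.
have D : cone_at (r + s).-1 (faceF k s T G) (ConePt r s k T G 0).
  by split=> //=; [rewrite lexx ler01|apply/funext => i; rewrite /coneF; ring].
rewrite (coh _ _ D); apply/funext => i.
by rewrite /cone_val /coneF /= step_le0//; ring.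
Qed.

(** Two faces through a common point impose the same subdivision.  The last
hypothesis only orders the two faces: the block of the first starts earlier, or
starts with the second and is not shorter. *)
Lemma graft_face_wlog r s k r' s' k' T G T' G' :
  (forall m, (m < (r + s).-1)%N -> coherent m) ->
  (r + s).-1 = (r' + s').-1 ->
  (1 < r)%N -> (1 < s)%N -> (k < r)%N -> (1 < r')%N -> (1 < s')%N -> (k' < r')%N ->
  assocF r T -> assocF s G -> assocF r' T' -> assocF s' G' ->
  faceF k s T G = faceF k' s' T' G' ->
  (k < k')%N || (k == k') && (s' <= s)%N ->
  graftF k s (subdiv r T) (subdiv s G) = graftF k' s' (subdiv r' T') (subdiv s' G').
Proof.
move=> coh En r1 s1 kr r'1 s'1 k'r AT AG AT' AG' E ord.
have [/andP[_ sn] ksn Bi Bs] := faceF_block r1 s1 kr AT AG.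
have B' := faceF_block r'1 s'1 k'r AT' AG'; rewrite -En -E in B'.
have [/andP[_ s'n] ksn' Bi' Bs'] := B'.
set F := faceF k s T G in E Bi Bs B' Bi' Bs'.
have [T0 Tm Tb Te] := AT; have [G0 Gm Gb Ge] := AG.
have [dis|ndis] := leqP (k + s) k'.
  (* The second block lies behind the first, hence in T, shifted by s - 1; so T
     is itself in a face, and both sides are the same double composite. *)
  have TF i : (k < i)%N -> F (i + s.-1)%N = T i + s.-1%:R.
    by move=> ki; rewrite /F /faceF; decide_ifs; rewrite addnK.
  set l := (k' - s.-1)%N.
  have BT : block r l s' T.
    have k'E : k' = (l + s.-1)%N by lia.
    have Tl i : T (l + i)%N - T l = F (k' + i)%N - F k'.
      by rewrite k'E addnAC !TF; [ring|lia|lia].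
    split; [lia|lia| |].
    - by move=> i il; rewrite Tl; exact: Bi'.
    - by rewrite Tl.
  have [W [G2 [AW AG2 TE]]] := block_faceF AT BT.
  have E2 : F = faceF k' s' (faceF k s W G) G2.
    rewrite /F TE -faceF_disjoint//; last lia.
    by congr faceF; lia.
  have AF2 : assocF r' (faceF k s W G).
    have -> : r' = (r - s'.-1 + s).-1 by lia.
    by apply: faceF_assocF => //; lia.
  rewrite E in E2; have [T'E G'E] := faceF_inj s'1 AT' AG' AF2 AG2 E2.
  rewrite G'E T'E TE; set w := (r - s'.-1)%N.
  have -> : r = (w + s').-1 by lia.
  have -> : r' = (w + s).-1 by lia.
  rewrite !coherent_face//; try apply: coh; try lia.
  have -> : k' = (l + s.-1)%N by lia.
  rewrite graftF_disjoint//; first lia.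
  by have [] := subdiv_weights G (ltnW s1).
(* If the blocks crossed, the increments of F over [k, k'] and [k', k + s], both
   before the end of a block, would add up to less than s - 1, the least
   increment over the whole first block. *)
have nest : (k' + s' <= k + s)%N.
  rewrite leqNgt; apply/negP => cross.
  have kk' : (k < k')%N by lia.
  have := Bi (k' - k)%N ltac:(lia); rewrite subnKC; last lia.
  have := Bi' (k + s - k')%N ltac:(lia); rewrite subnKC; last lia.
  move=> h1 h2; have : (k' - k).-1%:R + (k + s - k').-1%:R < s.-1%:R :> R.
    by rewrite -natrD ltr_nat; lia.
  lra.
have [same|diff] := boolP ((k == k') && (s == s')).
  move/andP: same => [/eqP ? /eqP ?]; subst k' s'.
  have ? : r' = r by lia.
  by subst r'; have [-> ->] := faceF_inj s1 AT AG AT' AG' E.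
(* The second block lies strictly inside the first, hence in G; so G is itself in
   a face, and both sides are again the same double composite. *)
set l := (k' - k)%N; have k'E : k' = (k + l)%N by lia.
have GF i : (i < s)%N -> F (k + i)%N = T k + G i.
  move=> ils; rewrite /F /faceF; have [->|i0] := posnP i.
    by rewrite addn0 leqnn G0 addr0.
  by decide_ifs; rewrite addKn.
have BG : block s l s' G.
  have Gl i : (l + i < s)%N -> G (l + i)%N - G l = F (k' + i)%N - F k'.
    by move=> h; rewrite k'E -addnA !GF; [ring|lia|lia].
  split; [lia|lia| |].
  - by move=> i il; rewrite Gl; [exact: Bi'|lia].
  - have [ls|ls] := ltnP (l + s') s; first by rewrite Gl.
    (* The blocks end together.  There G is truncated at s - 1, but still
       catches up, since G l <= l - 1. *)
    have -> : (l + s' = s)%N by lia.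
    rewrite Ge//; have l0 : (0 < l)%N by lia.
    have := Gb l.-1 ltac:(lia); rewrite prednK// => h.
    have : s'.-1%:R + l.-1%:R <= s.-1%:R :> R by rewrite -natrD ler_nat; lia.
    lra.
have [V [G2 [AV AG2 GE]]] := block_faceF AG BG.
set v := (s - s'.-1)%N in AV.
have sE : s = (v + s').-1 by lia.
have V0 : V 0%N = 0 by have [] := AV.
have E2 : F = faceF k' s' (faceF k v T V) G2.
  by rewrite /F GE {1}sE faceF_nested//; [congr faceF; lia|lia].
have AF2 : assocF r' (faceF k v T V).
  have -> : r' = (r + v).-1 by lia.
  by apply: faceF_assocF => //; lia.
rewrite E in E2; have [T'E G'E] := faceF_inj s'1 AT' AG' AF2 AG2 E2.
rewrite G'E T'E GE.
have -> : r' = (r + v).-1 by lia.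
rewrite [in LHS]sE !coherent_face//; try apply: coh; try lia.
rewrite k'E graftF_nested//; first lia.
by have [] := @subdiv_weights v V ltac:(lia).
Qed.

(** The height of X is determined by X.  At height 1 the value is the even
subdivision; below, the boundary point under X is determined as well, and
[graft_face_wlog] applies. *)
Lemma subdiv_coherent n : coherent n.
Proof.
elim/ltn_ind: n => n IH X d' D'; rewrite subdivE /cone_extend.
case: pselect => [h|]; last by case; exists d'.
case: cid => d D /= {h}.
case: d D => r s k T G t [/= [r1 s1 kr nE] AT AG /andP[t0 t1] XE].
case: d' D' => r' s' k' T' G' t' [/= [r1' s1' kr' nE'] AT' AG' /andP[t0' t1'] XE'].
have AF := faceF_assocF r1 s1 kr AT AG; rewrite -nE in AF.
have AF' := faceF_assocF r1' s1' kr' AT' AG'; rewrite -nE' in AF'.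
have B := faceF_block r1 s1 kr AT AG; rewrite -nE in B.
have B' := faceF_block r1' s1' kr' AT' AG'; rewrite -nE' in B'.
have [] := cone_boundary_inj B B' AF AF' t1 t1' (etrans (esym XE) XE').
move=> tE; rewrite -tE /cone_val /=; have [tlt|tge] := ltP t 1; last first.
  by move=> _; apply/funext => i; rewrite /coneF step_ge1//; ring.
move=> /(_ isT) EF; congr coneF.
case: (ltngtP k k') => kk.
- apply: graft_face_wlog => //; try lia; by rewrite -nE.
- apply/esym; apply: graft_face_wlog => //; try lia; by rewrite -nE'.
- have [ss|ss] := leqP s' s.
    by apply: graft_face_wlog => //; try lia; rewrite -nE.
  by apply/esym; apply: graft_face_wlog => //; try lia; rewrite -nE'.
Qed.

(** K_2 is a point: no face has 2 = r + s - 1 with r, s >= 2. *)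
Lemma subdiv2 X : subdiv 2 X = evenF R 2.
Proof.
rewrite subdivE /cone_extend; case: pselect => // h.
by case: (projT2 (cid h)) => -[r1 s1 _ nE] _ _ _ _; exfalso; clear -r1 s1 nE; lia.
Qed.

End Subdivision.

(** * Smoothness on the cubic complexes *)

Section CellSmoothness.
Variable R : realType.

Lemma coord_out n (t : 'rV[R]_n) i : (n <= i)%N -> Defs.coord t i = 0.
Proof. by move=> ni; rewrite /Defs.coord insubF// ltnNge ni. Qed.

Lemma assoc_assocF n (t : 'rV[R]_n) : (1 < n)%N -> assoc t -> assocF n (psum t).
Proof.
move=> n1 At; have [_ _ tn] := At; rewrite -/(psum _ _) in tn.
have pn : psum t n = n.-1%:R by rewrite -{2}[n]prednK 1?ltnW// psumS tn; ring.
have pn1 : psum t n.-1 <= n.-1%:R.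
  have [|_] := @assoc_psum R n t n.-2 At; first lia.
  by rewrite prednK; [|lia] => /le_trans; apply; rewrite ler_nat; lia.
have out i : (n <= i)%N -> psum t i = n.-1%:R.
  elim: i => [|i IH]; first by lia.
  rewrite leq_eqVlt => /predU1P[<-//|ni].
  by rewrite psumS coord_out// addr0 IH.
split=> //; first by rewrite /psum big_ord0.
- move=> i; rewrite psumS lerDl; have [il|il] := ltnP i n.-1.
    by have [] := assoc_psum At il.
  have [->|ni] := eqVneq i n.-1; first by rewrite tn subr_ge0.
  by rewrite coord_out//; lia.
- move=> i il; have [il'|il'] := ltnP i n.-1; first by have [] := assoc_psum At il'.
  have -> : i = n.-1 by lia.
  by rewrite prednK ?pn//; lia.
Qed.

Lemma psum_faceF r s (k : 'I_r) (t : 'rV[R]_r) (u : 'rV[R]_s) :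
  (1 < s)%N -> psum u s = s.-1%:R ->
  psum (face k t u) = faceF k s (psum t) (psum u).
Proof.
move=> s1 us; have [F1 F2 F3] := psum_face k t u s1.
apply/funext => i; rewrite /faceF; have [ik|ki] := leqP i k; first exact: F1.
have [iks|ksi] := ltnP i (k + s).
  by rewrite -[in LHS](subnKC (ltnW ki)) F2//; lia.
rewrite -[in LHS](subnKC ksi) F3 us; congr (psum _ _ + _); lia.
Qed.

Lemma psum_baryF n : (1 < n)%N -> psum (bary R n) = baryF R n.
Proof.
move=> n1; have [b0 _ _ be] := assoc_assocF n1 (assoc_bary R n1).
apply/funext => i; rewrite /baryF; case: ltnP => [il|/be//].
by have [->|i0] := posnP i; rewrite ?b0 ?mul0r// psum_bary// i0.
Qed.

Definition cuts n (t : 'rV[R]_n) := subdiv n (psum t).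

Lemma cuts_face r s (k : 'I_r) (t : 'rV[R]_r) (u : 'rV[R]_s) :
  (1 < r)%N -> (1 < s)%N -> assoc t -> assoc u ->
  cuts (face k t u) = graftF k s (cuts t) (cuts u).
Proof.
move=> r1 s1 /(assoc_assocF r1) At /(assoc_assocF s1) Au; rewrite /cuts.
rewrite psum_faceF ?coherent_face//; first exact: subdiv_coherent.
by have [_ _ _ ->] := Au.
Qed.

Lemma cuts_cone r s (k : 'I_r) (t : 'rV[R]_r) (u : 'rV[R]_s) (c : R) :
  (1 < r)%N -> (1 < s)%N -> assoc t -> assoc u -> 0 <= c <= 1 ->
  cuts ((1 - c) *: face k t u + c *: bary R (r + s).-1) =
  coneF (step c) (cuts (face k t u)) (evenF R (r + s).-1).
Proof.
move=> r1 s1 At Au c01; rewrite cuts_face// /cuts.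
move: At Au => /(assoc_assocF r1) At /(assoc_assocF s1) Au.
pose d := ConePt r s k (psum t) (psum u) c.
apply: (@subdiv_coherent _ _ _ d); split=> //=.
apply/funext => i; rewrite psum_comb psum_faceF//; last by have [_ _ _ ->] := Au.
by rewrite psum_baryF//; lia.
Qed.

Lemma smooth_lsubmx m n : smooth_map setT (@lsubmx R 1 m n).
Proof.
move=> j; apply: (smooth_fun_ext openT _ (@smooth_map_id R _ setT (lshift n j))) => x _.
by rewrite mxE.
Qed.

Lemma smooth_rsubmx m n : smooth_map setT (@rsubmx R 1 m n).
Proof.
move=> j; apply: (smooth_fun_ext openT _ (@smooth_map_id R _ setT (rshift m j))) => x _.
by rewrite mxE.
Qed.

Lemma smooth_graftF m (U : set 'rV[R]_m) k s S Q : open U ->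
  (forall i, smooth_fun U (S ^~ i)) -> (forall i, smooth_fun U (Q ^~ i)) ->
  forall i, smooth_fun U (fun x => graftF k s (S x) (Q x) i).
Proof.
move=> oU sS sQ i; rewrite /graftF.
have [ik|ki] := leqP i k; first exact: sS.
have [iks|ksi] := leqP i (k + s); last exact: sS.
by apply: smooth_funD => //; apply: smooth_funM => //; exact: smooth_funB.
Qed.

Lemma smooth_coneF m (U : set 'rV[R]_m) c S Q : open U ->
  smooth_fun U c ->
  (forall i, smooth_fun U (S ^~ i)) -> (forall i, smooth_fun U (Q ^~ i)) ->
  forall i, smooth_fun U (fun x => coneF (c x) (S x) (Q x) i).
Proof.
move=> oU sc sS sQ i; rewrite /coneF.
apply: smooth_funD => //; apply: smooth_funM => //; apply: smooth_funB => //.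
exact: smooth_fun_cst.
Qed.

Lemma cell_par_assoc n (c : cell n) x : assoc (@cell_par R n c x).
Proof. exact/cell_sub_assoc/cell_par_in. Qed.

(** By induction on the cell: a face gives a polynomial in the values on its
factors, and a join mixes these with constants in a proportion given by [step]. *)
Lemma smooth_cuts_cell n (c : cell n) i :
  smooth_fun setT (fun x => cuts (@cell_par R n c x) i).
Proof.
have comp m m' (h : 'rV[R]_m -> 'rV[R]_m') f : smooth_map setT h ->
    smooth_fun setT f -> smooth_fun setT (fun x => f (h x)).
  by move=> sh sf; apply: smooth_fun_comp openT _ sh sf.
elim: c i => [m m1|r s k a IHa b IHb|r s k a IHa b IHb] i /=.
- exact: smooth_fun_cst.
- have r1 := cell_gt1 a; have s1 := cell_gt1 b.
  apply: (smooth_fun_ext openT _ (smooth_graftF k s openT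
     (fun j => comp _ _ _ _ (@smooth_lsubmx _ _) (IHa j))
     (fun j => comp _ _ _ _ (@smooth_rsubmx _ _) (IHb j)) i)) => x _.
  by rewrite cuts_face//; exact: cell_par_assoc.
- have r1 := cell_gt1 a; have s1 := cell_gt1 b.
  have sG j := smooth_graftF k s openT
     (fun j => comp _ _ _ _ (@smooth_lsubmx _ _) (IHa j))
     (fun j => comp _ _ _ _ (@smooth_rsubmx _ _) (IHb j)) j.
  have sG' j := comp _ _ _ _ (@smooth_lsubmx _ 1) (sG j).
  have st := smooth_fun_step openT (@smooth_rsubmx (cell_dim a + cell_dim b) 1 0).
  apply: (smooth_fun_ext openT _ (smooth_coneF openT st sG'
    (fun j => @smooth_fun_cst _ _ setT (evenF R (r + s).-1 j)) i)) => x _.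
  rewrite cuts_cone//; try exact: cell_par_assoc; last exact: pi_set01.
  by rewrite step_pi_set cuts_face//; exact: cell_par_assoc.
Qed.

(** The universal property of a finest diffeology is tested against the
diffeology that the candidate map pulls back from its target. *)
Definition pullback T (Y : diffSpace R) (f : T -> Y) : diffeology R T.
Proof.
exists (fun m U P => plot U (f \o P)).
- by move=> m U P; exact: plot_open.
- by move=> m U P Q PQ; apply: plot_ext => x xU; rewrite /= PQ.
- by move=> m U t oU; exact: (plot_cst (dstruct Y) (f t) oU).
- by move=> m U P; exact: plot_local.
- by move=> m n U V P h; exact: plot_comp.
Defined.

Lemma smooth_finest T (C : diffeology R T -> Prop) (Y : diffSpace R) (f : T -> Y) :
  C (pullback f) -> @smooth R (DiffSpace (finest_diffeology C)) Y f.
Proof. by move=> Cf m U P [_ /(_ _ Cf)]. Qed.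

Lemma smooth_cuts n i :
  @smooth R (cubic_assoc R n) (real_space R) (fun t => cuts (\val t) i).
Proof.
apply: smooth_finest => c; apply: (@smooth_finest _ _ (DiffSpace _)).
move=> m U P [oU sP]; split=> //.
exact: (smooth_fun_comp oU _ sP (@smooth_cuts_cell n c i)).
Qed.

End CellSmoothness.

(** * Gluing plots at the base point *)

Section Gluing.
Variables (R : realType) (X : diffSpace R) (a : X).

Lemma smooth_fun_continuous m (U : set 'rV[R]_m) (q : 'rV[R]_m -> R) x :
  smooth_fun U q -> U x -> {for x, continuous q}.
Proof. by move=> sq Ux; apply: differentiable_continuous; exact: (sq [::]). Qed.

Lemma open_smooth_preim m (U : set 'rV[R]_m) (q : 'rV[R]_m -> R) (V : set R) :
  open U -> smooth_fun U q -> open V -> open (U `&` q @^-1` V).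
Proof.
move=> oU sq oV; rewrite openE => x [Ux Vqx].
apply: filterI; first by apply: open_nbhs_nbhs.
by apply: (smooth_fun_continuous sq Ux); apply: open_nbhs_nbhs.
Qed.

Lemma eq_plot (Y : diffSpace R) m (V : set 'rV[R]_m) (P Q : 'rV[R]_m -> Y) :
  {in V, P =1 Q} -> plot V P -> plot V Q.
Proof. exact: plot_ext. Qed.

Lemma sub_plot (Y : diffSpace R) m (U V : set 'rV[R]_m) (P : 'rV[R]_m -> Y) :
  open V -> V `<=` U -> plot U P -> plot V P.
Proof. exact: plot_restrict. Qed.

(** Away from the zeros of q the glued map is one of the two plots.  Near a zero
both plots lie in the reflexive neighbourhood S of a, and composing with a real
function phi on S turns the gluing into a sum, because one of the two values is
always a. *)
Lemma plot_glue (X_refl : reflexive_at a) m (U : set 'rV[R]_m)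
    (P1 P2 : 'rV[R]_m -> X) (q : 'rV[R]_m -> R) :
  plot U P1 -> plot U P2 -> smooth_fun U q ->
  (forall x, U x -> 0 <= q x -> P1 x = a) ->
  (forall x, U x -> q x <= 0 -> P2 x = a) ->
  plot U (fun x => if q x <= 0 then P1 x else P2 x).
Proof.
move=> pP1 pP2 sq P1a P2a; have oU := plot_open pP1.
have [S [oS Sa reflS]] := X_refl.
apply: plot_local => x Ux; have [qx|qx|qx] := ltgtP (q x) 0.
- exists (U `&` q @^-1` [set y | y < 0]); split; [by []|by move=> ? []|].
  have oV := open_smooth_preim oU sq (@open_lt _ 0).
  apply: (@eq_plot _ _ _ P1); last by apply: sub_plot oV _ pP1 => ? [].
  by move=> y; rewrite inE => -[_ /= qy]; rewrite ltW.
- exists (U `&` q @^-1` [set y | 0 < y]); split; [by []|by move=> ? []|].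
  have oV := open_smooth_preim oU sq (@open_gt _ 0).
  apply: (@eq_plot _ _ _ P2); last by apply: sub_plot oV _ pP2 => ? [].
  by move=> y; rewrite inE => -[_ /= qy]; rewrite leNgt qy.
pose V := (U `&` P1 @^-1` S) `&` (U `&` P2 @^-1` S).
have oV : open V by apply: openI; exact: oS.
have VU : V `<=` U by move=> y [[]].
exists V; split=> //.
  by split; split=> //; rewrite /preimage /= ?P1a ?P2a ?qx.
pose sa : sub_space S := SigSub (mem_set Sa).
(* Plots are total functions, so the corestriction to S needs some value outside
   of S; a serves. *)
pose lift (y : X) : sub_space S :=
  if pselect (S y) is left Sy then SigSub (mem_set Sy) else sa.
have liftK y : S y -> \val (lift y) = y by move=> Sy; rewrite /lift; case: pselect.
have lifta : lift a = sa by apply/val_inj; rewrite liftK.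
have pl P : plot U P -> (forall y, V y -> S (P y)) ->
    plot V (fun y => lift (P y)).
  move=> pP SP; apply: (@eq_plot X _ _ P); last exact: sub_plot oV VU pP.
  by move=> y; rewrite inE => /SP Sy; rewrite liftK.
have pl1 := pl _ pP1 (fun y => fun '(conj (conj _ h) _) => h).
have pl2 := pl _ pP2 (fun y => fun '(conj _ (conj _ h)) => h).
have : plot V (fun y => lift (if q y <= 0 then P1 y else P2 y)).
  apply: reflS => // phi sphi; split=> //.
  have [_ s1] := sphi _ _ _ pl1; have [_ s2] := sphi _ _ _ pl2.
  apply: (smooth_fun_ext oV _ (smooth_funB oV (smooth_funD oV s1 s2)
    (@smooth_fun_cst _ _ V (phi sa)))) => y; rewrite inE => Vy /=.
  case: (leP (q y) 0) => qy.
    by rewrite (P2a y (VU _ Vy) qy) lifta addrK.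
  by rewrite (P1a y (VU _ Vy) (ltW qy)) lifta addrAC subrr add0r.
apply: (@eq_plot X) => y; rewrite inE => -[[_ S1] [_ S2]].
by case: ifP => _; exact: liftK.
Qed.

End Gluing.

(** * Concatenation of loops *)

Section Loops.
Variables (R : realType) (X : diffSpace R) (a : X).

Definition loop_fun (u : loop_space a) : R -> X := \val (\val u).

Definition is_loop (f : R -> X) :=
  [/\ @smooth R (real_space R) X f, f \o pi_set (R := R) = f, f 0 = a & f 1 = a].

(** Total on all functions, so that the A-infinity form can be written down
before its values are known to be loops. *)
Definition mk_loop (f : R -> X) : loop_space a :=
  if pselect (is_loop f) is left H then
    let: And4 sf fp f0 f1 := H in
    SigSub (mem_set (And3 fp f0 f1 :
      loops a (SigSub (mem_set (sf : [set g : real_space R -> X | smooth g] f)) : fun_space (real_space R) X)))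
  else const_loop a.

Lemma mk_loopK f : is_loop f -> loop_fun (mk_loop f) = f.
Proof. by move=> H; rewrite /mk_loop; case: pselect => // -[]. Qed.

Lemma loop_funP u : is_loop (loop_fun u).
Proof. by have [up u0 u1] := set_valP u; split=> //; exact: (set_valP (\val u)). Qed.

Lemma loop_fun_inj : injective loop_fun.
Proof. by move=> u v uv; do 2 apply: val_inj. Qed.

Lemma is_loop_le0 f t : is_loop f -> t <= 0 -> f t = a.
Proof.
move=> [_ fp f0 _] t0; rewrite -fp /= /pi_set max_l//.
by rewrite ge_min t0 orbT.
Qed.

Lemma is_loop_ge1 f t : is_loop f -> 1 <= t -> f t = a.
Proof. by move=> [_ fp _ f1] t1; rewrite -fp /= /pi_set min_l// max_r. Qed.

Lemma is_loopI f : @smooth R (real_space R) X f ->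
  (forall t, t <= 0 -> f t = a) -> (forall t, 1 <= t -> f t = a) -> is_loop f.
Proof.
move=> sf fle fge; split=> //; [|exact: fle|exact: fge].
apply/funext => t /=; rewrite /pi_set; have [t1|t1] := leP 1 t.
  by rewrite max_r// !fge.
by have [t0|t0] := leP 0 t; rewrite // !fle// ltW.
Qed.

Lemma plot_loop m (U : set 'rV[R]_m) (P : 'rV[R]_m -> loop_space a) :
  plot U P <-> open U /\
    forall n (V : set 'rV[R]_n) (h : 'rV[R]_n -> 'rV[R]_m) (q : 'rV[R]_n -> R),
      open V -> smooth_map V h -> h @` V `<=` U -> smooth_fun V q ->
      plot V (fun v => loop_fun (P (h v)) (q v)).
Proof.
split=> [[oU H]|[oU H]]; split=> // n V h q.
  by move=> oV sh hVU sq; exact: (H _ _ _ _ sh hVU (conj oV sq)).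
by move=> sh hVU [oV sq]; exact: H.
Qed.

Definition piece (S : nat -> R) (g : nat -> R -> X) i (t : R) :=
  g i ((t - S i) / (S i.+1 - S i)).

(** The concatenation of g 0, ..., g n along the division points S.  The first
and the last piece are used outside of [S 0, S n.+1] too, where they have the
value a.  The test reads t - S n <= 0 to match the form of [plot_glue]. *)
Fixpoint concat (S : nat -> R) (g : nat -> R -> X) n (t : R) :=
  if n is n'.+1 then
    if t - S n <= 0 then concat S g n' t else piece S g n t
  else piece S g 0 t.

Lemma eq_concat S g g' n t : (forall i, (i <= n)%N -> g i = g' i) ->
  concat S g n t = concat S g' n t.
Proof.
elim: n => [|n IH] gg; first by rewrite /= /piece gg.
by rewrite /= IH /piece ?gg// => i il; exact/gg/leqW.
Qed.

Section Pieces.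
Variables (S : nat -> R) (g : nat -> R -> X).
Hypothesis gloop : forall i, is_loop (g i).

Lemma knots_mono n j k : (forall i, (i <= n)%N -> S i < S i.+1) ->
  (j <= k)%N -> (k <= n.+1)%N -> S j <= S k.
Proof.
move=> Si; elim: k => [|k IHk]; first by rewrite leqn0 => /eqP->.
rewrite leq_eqVlt => /predU1P[->//|jk] kn.
by apply: le_trans (IHk jk (ltnW kn)) (ltW (Si _ _)).
Qed.

Lemma piece_le i t : S i < S i.+1 -> t <= S i -> piece S g i t = a.
Proof.
move=> Si tS; apply: (is_loop_le0 (gloop i)).
by rewrite pmulr_lle0 ?subr_le0// invr_gt0 subr_gt0.
Qed.

Lemma piece_ge i t : S i < S i.+1 -> S i.+1 <= t -> piece S g i t = a.
Proof.
move=> Si tS; apply: (is_loop_ge1 (gloop i)).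
by rewrite ler_pdivlMr ?subr_gt0// mul1r lerD2r.
Qed.

Lemma concat_ge n t : (forall i, (i <= n)%N -> S i < S i.+1) ->
  S n.+1 <= t -> concat S g n t = a.
Proof.
case: n => [|n] Si St; first by apply: piece_ge => //; exact: Si.
rewrite /= subr_le0 leNgt (lt_le_trans (Si _ _) St)//.
by apply: piece_ge => //; exact: Si.
Qed.

Lemma concat_piece n i t : (forall i, (i <= n)%N -> S i < S i.+1) ->
  (i <= n)%N -> S i <= t -> t <= S i.+1 -> concat S g n t = piece S g i t.
Proof.
elim: n => [|n IH] Si; first by case: i.
have {}IH := IH (fun i h => Si i (leqW h)).
rewrite leq_eqVlt => /predU1P[-> St tS|]; rewrite /= subr_le0.
  case: leP => // tSn; rewrite concat_ge//; last by move=> j jn; exact/Si/leqW.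
  by rewrite piece_le//; exact: Si.
rewrite ltnS => il St tS; rewrite ifT; first exact: IH.
apply: le_trans tS _.
have [->//|] := eqVneq i n; move=> /eqP ni.
by apply: (knots_mono Si); lia.
Qed.

Lemma concat_le n t : (forall i, (i <= n)%N -> S i < S i.+1) ->
  t <= S 0%N -> concat S g n t = a.
Proof.
elim: n => [|n IH] Si St; first by apply: piece_le => //; exact: Si.
rewrite /= subr_le0 (le_trans St); last by apply: (knots_mono Si).
by apply: IH => // i il; exact/Si/leqW.
Qed.

End Pieces.

Lemma plot_concat (X_refl : reflexive_at a) n m (U : set 'rV[R]_m)
    (S : 'rV[R]_m -> nat -> R) (g : 'rV[R]_m -> nat -> R -> X)
    (q : 'rV[R]_m -> R) :
  open U -> (forall i, smooth_fun U (S ^~ i)) ->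
  (forall x i, (i <= n)%N -> S x i < S x i.+1) ->
  (forall x i, is_loop (g x i)) ->
  (forall i q', smooth_fun U q' -> plot U (fun x => g x i (q' x))) ->
  smooth_fun U q -> plot U (fun x => concat (S x) (g x) n (q x)).
Proof.
move=> oU sS Si gl sg sq.
have piece_plot i : (i <= n)%N -> plot U (fun x => piece (S x) (g x) i (q x)).
  move=> il; apply: sg; apply: smooth_funM => //; first exact: smooth_funB.
  apply: smooth_funV => //; last exact: smooth_funB.
  by move=> x _; rewrite gt_eqF// subr_gt0 Si.
elim: n Si piece_plot => [|n IH] Si pp; first exact: pp.
apply: (@plot_glue _ _ _ X_refl _ _ _ _ (fun x => q x - S x n.+1)).
- by apply: IH => [x i il|i il]; [exact/Si/leqW|exact/pp/leqW].
- exact: pp.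
- exact: smooth_funB.
- move=> x _; rewrite subr_ge0; apply: concat_ge => // i il; exact/Si/leqW.
- by move=> x _; rewrite subr_le0; apply: piece_le => //; exact: Si.
Qed.

Lemma smooth_plotR m (U : set 'rV[R]_m) (f : R -> X) q : open U ->
  @smooth R (real_space R) X f -> smooth_fun U q -> plot U (fun x => f (q x)).
Proof. by move=> oU sf sq; exact: (sf _ _ q (conj oU sq)). Qed.

Lemma concat_loop (X_refl : reflexive_at a) n S g :
  weights n.+1 S -> (forall i, is_loop (g i)) -> is_loop (concat S g n).
Proof.
move=> [S0 Sn Si] gl; apply: is_loopI => [m U q [oU sq]|t t0|t t1].
- apply: (plot_concat (S := fun=> S) (g := fun=> g) X_refl oU) => //.
  + by move=> i; exact: smooth_fun_cst.
  + by move=> i q' sq'; apply: smooth_plotR => //; case: (gl i).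
- by apply: concat_le => //; rewrite S0.
- by apply: concat_ge => //; rewrite Sn.
Qed.

Lemma weights_locate n (S : nat -> R) t : weights n S -> 0 <= t <= 1 -> (0 < n)%N ->
  exists i, [/\ (i < n)%N, S i <= t & t <= S i.+1].
Proof.
move=> [S0 Sn _] /andP[t0 t1] n0; rewrite -Sn in t1; rewrite -S0 in t0.
elim: n n0 t1 {Sn} => // n IH _ t1; have [tn|nt] := leP t (S n).
  have [n0|n0] := posnP n; first by exists 0%N; split=> //; rewrite -n0.
  by have [i [il ? ?]] := IH n0 tn; exists i; split=> //; exact: ltnW.
by exists n; split=> //; exact: ltW.
Qed.

(** Concatenation is a morphism of operads: grafting Q into the k-th interval of
S amounts to replacing the k-th loop by a concatenation along Q.  Both sides
run through the same loop at the same affine speed on each interval. *)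
Lemma concat_graft r s k (S Q : nat -> R) (g g' : nat -> R -> X) :
  (1 < r)%N -> (1 < s)%N -> (k < r)%N -> weights r S -> weights s Q ->
  (forall i, is_loop (g i)) -> (forall i, is_loop (g' i)) ->
  (forall i, (i < k)%N -> g' i = g i) ->
  g' k = concat Q (fun j => g (k + j)%N) s.-1 ->
  (forall i, (k < i < r)%N -> g' i = g (i + s.-1)%N) ->
  concat (graftF k s S Q) g (r + s).-2 = concat S g' r.-1.
Proof.
move=> r1 s1 kr WS WQ gl gl' glt geq ggt.
have WG := graftF_weights r1 s1 kr WS WQ.
have [S0 Sr Si] := WS; have [Q0 Qs Qi] := WQ; have [G0 Gn Gi] := WG.
apply/funext => t; have Gi' i : (i <= (r + s).-2)%N ->
    graftF k s S Q i < graftF k s S Q i.+1 by move=> il; apply: Gi; lia.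
have Si' i : (i <= r.-1)%N -> S i < S i.+1 by move=> il; apply: Si; lia.
have Qi' i : (i <= s.-1)%N -> Q i < Q i.+1 by move=> il; apply: Qi; lia.
have [t0|t0] := leP t 0; first by rewrite !concat_le// ?S0 ?G0.
have [t1|t1] := leP 1 t.
  have e1 : (r + s).-2.+1 = (r + s).-1 by lia.
  have e2 : r.-1.+1 = r by lia.
  by rewrite !concat_ge ?e1 ?e2 ?Gn ?Sr.
have t01 : 0 <= t <= 1 by rewrite !ltW.
have [i [ir St tS]] := weights_locate WS t01 (ltnW r1).
rewrite (@concat_piece S g' _ r.-1 i)//; last lia.
have [ik|ki|ik] := ltngtP i k.
- have Ei j : (j <= k)%N -> graftF k s S Q j = S j by rewrite /graftF => ->.
  rewrite (@concat_piece _ g _ _ i) ?Ei//; try lia.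
  by rewrite /piece !Ei ?glt//; lia.
- have Ei j : (k < j)%N -> graftF k s S Q (j + s.-1)%N = S j.
    move=> kj; rewrite /graftF; decide_ifs; rewrite addnK.
    case: leqP => // jk; have -> : j = k.+1 by lia.
    by rewrite (_ : k.+1 + s.-1 - k = s)%N ?Qs; [ring|lia].
  have := Ei i.+1 ltac:(lia); rewrite addSn => Ei1.
  rewrite (@concat_piece _ g _ _ (i + s.-1)%N) ?Ei1 ?Ei//; try lia.
  by rewrite /piece Ei1 Ei// ggt//; lia.
subst i; have d0 : 0 < S k.+1 - S k by rewrite subr_gt0 Si.
have Ej j : (j <= s)%N -> graftF k s S Q (k + j)%N = S k + (S k.+1 - S k) * Q j.
  move=> js; rewrite /graftF; have [->|j0] := posnP j.
    by rewrite addn0 leqnn Q0; ring.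
  by decide_ifs; rewrite addKn.
rewrite /piece geq; set t' := (t - S k) / _.
have tE : t = S k + (S k.+1 - S k) * t' by rewrite /t'; field; rewrite gt_eqF.
have t'01 : 0 <= t' <= 1.
  by rewrite divr_ge0 ?(ltW d0) ?subr_ge0//= ler_pdivrMr// mul1r lerD2r.
have [j [js Qt tQ]] := weights_locate WQ t'01 (ltnW s1).
have Ej1 := Ej j.+1 js; rewrite addnS in Ej1; have {}Ej := Ej j (ltnW js).
have js' : (j <= s.-1)%N by clear -js; lia.
have kj : (k + j <= (r + s).-2)%N by clear -js kr; lia.
rewrite (concat_piece (fun j => gl (k + j)%N) Qi' js' Qt tQ).
rewrite (concat_piece gl Gi' kj); first last.
- by rewrite Ej1 {1}tE lerD2l ler_pM2l.
- by rewrite Ej {1}tE lerD2l ler_pM2l.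
rewrite /piece Ej Ej1 {1}tE; congr g.
have q0 : 0 < Q j.+1 - Q j by rewrite subr_gt0 Qi.
field; rewrite gt_eqF//= gt_eqF//; have := mulr_gt0 d0 q0; lra.
Qed.

End Loops.

(** * The A-infinity form *)

Section LoopSpace.
Variables (R : realType) (X : diffSpace R) (a : X).
Hypothesis X_refl : reflexive_at a.

Local Notation LX := (loop_space a).
Local Notation e := (const_loop a).

Definition loops_at n (g : n.-tuple LX) (i : nat) : R -> X :=
  loop_fun (nth e g i).

Definition loop_form n (x : prod_space (cubic_assoc R n) (pow_space LX n)) : LX :=
  mk_loop a (concat (cuts (\val x.1)) (loops_at x.2) n.-1).

Lemma cuts_weights n (t : 'rV[R]_n) : (0 < n)%N -> weights n (cuts t).
Proof. exact: subdiv_weights. Qed.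

Lemma loop_formE n x : (1 < n)%N ->
  loop_fun (@loop_form n x) = concat (cuts (\val x.1)) (loops_at x.2) n.-1.
Proof.
move=> n1; apply: mk_loopK; apply: (concat_loop X_refl) => [|i].
  by rewrite prednK ?(ltnW n1)//; apply: cuts_weights; exact: ltnW.
exact: loop_funP.
Qed.

Lemma smooth_fun_comp_map m n (U : set 'rV[R]_m) (V : set 'rV[R]_n) h (f : 'rV[R]_m -> R) :
  open V -> smooth_map V h -> h @` V `<=` U -> smooth_fun U f ->
  smooth_fun V (fun v => f (h v)).
Proof. by move=> oV sh hVU sf; exact: (smooth_fun_comp oV hVU sh sf). Qed.

Lemma smooth_loop_form n : (1 < n)%N -> smooth (@loop_form n).
Proof.
move=> n1 m U P [P1 [oU P2]]; apply/plot_loop; split=> // k V h q oV sh hVU sq.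
apply: (@eq_plot _ _ _ _ (fun v => concat (cuts (\val (P (h v)).1))
    (loops_at (P (h v)).2) n.-1 (q v))) => [v _|]; first by rewrite /= loop_formE.
apply: (plot_concat (S := fun v => cuts (\val (P (h v)).1))
  (g := fun v => loops_at (P (h v)).2) X_refl oV) => //.
- move=> i; have [_ sc] := smooth_cuts i P1.
  exact: (smooth_fun_comp_map oV sh hVU sc).
- move=> v i il; have [_ _] := cuts_weights (\val (P (h v)).1) (ltnW n1).
  by apply; lia.
- by move=> v i; exact: loop_funP.
- move=> i q' sq'; rewrite /loops_at; have [il|il] := ltnP i n.
    have /plot_loop[_ pi] := P2 (Ordinal il).
    apply: (@eq_plot _ _ _ _ _ _ _ (pi _ V h q' oV sh hVU sq')) => v _.
    by rewrite (tnth_nth e).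
  apply: (@eq_plot _ _ _ _ (fun=> a)) => [v _|].
    by rewrite nth_default// size_tuple.
  exact: (plot_cst (dstruct X) a oV).
Qed.

Lemma loop_form_face r s (r1 : (1 < r)%N) (s1 : (1 < s)%N) (k : 'I_r)
    (t : cubic_assoc R r) (u : cubic_assoc R s) (g : (r + s).-1.-tuple LX) :
  loop_form (faceK r1 s1 k t u, g) =
  loop_form (t, [tuple
    if (i < k)%N then nth e g i
    else if i == k then loop_form (u, [tuple nth e g (k + j) | j < s])
    else nth e g (i + s.-1) | i < r]).
Proof.
apply: loop_fun_inj; rewrite !loop_formE//; last lia.
have nthE m (f : 'I_m -> LX) (i : nat) (im : (i < m)%N) :
    nth e [tuple f i | i < m] i = f (Ordinal im).
  by rewrite -[i]/(val (Ordinal im)) -tnth_nth tnth_mktuple.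
rewrite cuts_face//; try exact: set_valP.
apply: concat_graft => //; try by move=> i; exact: loop_funP.
- exact: cuts_weights (ltnW r1).
- exact: cuts_weights (ltnW s1).
- move=> i ik; have ir : (i < r)%N by apply: ltn_trans ik _.
  by rewrite /loops_at (nthE _ _ _ ir) /= ik.
- rewrite /loops_at (nthE _ _ _ (ltn_ord k)) /= ltnn ifT; last exact/eqP/val_inj.
  rewrite loop_formE//; apply/funext => x /=; apply: eq_concat => j js.
  have js' : (j < s)%N by lia.
  by rewrite /loops_at (nthE _ (fun j : 'I_s => nth e g (k + j)) _ js').
- move=> i /andP[ki ir]; rewrite /loops_at (nthE _ _ _ ir) /= ltnNge ltnW//= ifF//.
  by apply/negbTE; rewrite -val_eqE /= gtn_eqF.
Qed.

(** The conditions on c and b + c say that t |-> b t + c maps the points outside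
of ]0, 1[ to points outside of ]0, 1[ on the same side, so that the
reparametrized path is again a loop. *)
Lemma smooth_affine_loop m (U : set 'rV[R]_m) (P : 'rV[R]_m -> LX) b c :
  plot U P -> smooth_fun U b -> smooth_fun U c ->
  (forall x, c x <= 0) -> (forall x, 1 <= b x + c x) -> 
  plot U (fun x => mk_loop a (fun t => loop_fun (P x) (b x * t + c x))).
Proof.
move=> pP sb sc c0 bc1; have oU := plot_open pP.
have b0 x : 0 < b x by have := c0 x; have := bc1 x; lra.
have /plot_loop[_ pP'] := pP.
apply/plot_loop; split=> // n V h q oV sh hVU sq.
apply: (@eq_plot _ _ _ _ (fun v => loop_fun (P (h v)) (b (h v) * q v + c (h v)))).
  move=> v _; rewrite mk_loopK//; have lP := loop_funP (P (h v)).
  apply: is_loopI => [m' U' f [oU' sf]|t t0|t t1].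
  - apply: (smooth_plotR (f := loop_fun (P (h v))) oU'); first by case: lP.
    exact: (smooth_funD oU' (smooth_funM oU' (@smooth_fun_cst _ _ U' (b (h v))) sf)
      (@smooth_fun_cst _ _ U' (c (h v)))).
  - apply: (is_loop_le0 lP).
    have := mulr_ge0_le0 (ltW (b0 (h v))) t0; have := c0 (h v) => ? ?; lra.
  - apply: (is_loop_ge1 lP).
    have := bc1 (h v); have := b0 (h v) => ? ?; nra.
apply: pP' => //; apply: smooth_funD => //; last exact: smooth_fun_comp_map sc.
by apply: smooth_funM => //; exact: smooth_fun_comp_map sb.
Qed.

(** The affine maps allowed for reparametrizations form a convex set that
contains the identity; [step] extends the segment to all real times. *)
Lemma affine_homotopic (f : LX -> LX) (b c : R) : c <= 0 -> 1 <= b + c ->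
  (forall g t, loop_fun (f g) t = loop_fun g (b * t + c)) -> homotopic f id.
Proof.
move=> c0 bc1 fE.
exists (fun x => mk_loop a (fun t =>
  loop_fun x.2 ((b + step x.1 * (1 - b)) * t + (1 - step x.1) * c))).
split=> [m U P [[oU P1] P2]|g|g].
- have s1 := smooth_fun_step oU P1.
  apply: (@smooth_affine_loop _ _ _ (fun x => b + step (P x).1 * (1 - b))
    (fun x => (1 - step (P x).1) * c) P2).
  + apply: smooth_funD => //; first exact: smooth_fun_cst.
    by apply: smooth_funM => //; exact: smooth_fun_cst.
  + apply: smooth_funM => //; last exact: smooth_fun_cst.
    by apply: smooth_funB => //; exact: smooth_fun_cst.
  + move=> x; have /andP[? ?] := step01 (P x).1; nra.
  + move=> x; have /andP[? ?] := step01 (P x).1; nra.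
- apply: loop_fun_inj; rewrite /= step_le0// (_ : (fun t => _) = loop_fun (f g)).
    by rewrite mk_loopK//; exact: loop_funP.
  by apply/funext => t; rewrite fE; congr loop_fun; ring.
- apply: loop_fun_inj; rewrite /= step_ge1// (_ : (fun t => _) = loop_fun g).
    by rewrite mk_loopK//; exact: loop_funP.
  by apply/funext => t; congr loop_fun; ring.
Qed.

Lemma loop_form2 (t : cubic_assoc R 2) (u v : LX) x :
  loop_fun (loop_form (t, [tuple u; v])) x =
  if x <= 1 / 2 then loop_fun u (2 * x) else loop_fun v (2 * x - 1).
Proof.
rewrite loop_formE//= /cuts subdiv2 /piece /evenF /loops_at /= subr_le0.
by case: ifP => _; congr loop_fun; field.
Qed.

End LoopSpace.

Theorem corollary6p12 (R : realType) (X : diffSpace R) (a : X)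
    (X_refl : reflexive_at a) :
  h_unital_A_infty_space (const_loop a).
Proof.
exists (@loop_form R X a); split.
- split; first by move=> n; exact: smooth_loop_form.
  by move=> r s r1 s1 k t u g; exact: loop_form_face.
- apply: (@affine_homotopic _ _ _ _ 2 (-1)) => [||g t]; [lra|lra|].
  rewrite loop_form2//; case: leP => // th.
  by rewrite (is_loop_le0 (loop_funP g))//; lra.
- apply: (@affine_homotopic _ _ _ _ 2 0) => [||g t]; [lra|lra|].
  rewrite loop_form2// addr0; case: leP => // th.
  by rewrite (is_loop_ge1 (loop_funP g))//; lra.
Qed.
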